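(* Let $p>1$, let $\Omega\subset\mathbb{R}^N$ be a bounded domain with $N>p$, and put $p^*=\frac{pN}{N-p}$. Let $J(u)=\frac1p\widehat M(\|u\|_W^p)-\int_\Omega F(x,u)\,dx$ for $u\in W_0^{1,p}(\Omega)$, where, for some constant $C_0>0$, $F(x,v)\le C_0(1+|v|^{p^*})$ for all $x\in\Omega$, $v\in\mathbb{R}$. Let $r>p^*\ge\varpi>q\ge1$ and assume that for suitable constants $C_1,C_2,C_3>0$: (i) $\frac1p\widehat M(s^p)\le C_1 s^r$ for all small $s\geq 0$; (ii) $F(x,v)\ge C_2v^{\varpi}-C_3v^q$ for all $x\in\Omega$, $v\ge0$. Then there exists a sequence $(u_n)$ in $W_0^{1,p}(\Omega)$ with $\|u_n\|_W\to0$ such that $J(u_n)<0$ for all $n$. In particular, if also (iii) $\widehat M(t)\ge0$ for all small $t\ge0$, and (iv) $F(x,v)\le0$ for all $x\in\Omega$ and all $v$ with $|v|$ small (uniformly in $x$), then the origin is a local minimum for $J$ with respect to the $\mathcal{C}^1$ norm, but not with respect to the $W_0^{1,p}$ norm. Finally, if moreover (in addition to (iv)) $\widehat M(t)\ge0$ for every $t\ge0$, then the origin is a local minimum for $J$ with respect to the $\mathcal{C}^1$ norm and with respect to the $L^\infty$ norm, but not with respect to the $W_0^{1,p}$ norm.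
   Context: $\|u\|_W=\left(\int_\Omega|\nabla u|^p\right)^{1/p}$ is the norm of $W_0^{1,p}(\Omega)$. $M$ is a real function, integrable at $0$ and continuous on $(0,\infty)$; $\widehat M(t)=\int_0^tM(s)\,ds$ for $t\ge0$. $F(x,v)=\int_0^vf(x,s)\,ds$, where $f:\Omega\times\mathbb{R}\to\mathbb{R}$ is a nonlinearity regular enough that $F$ is a Carathéodory function, so $F(x,0)=0$ and $J(0)=0$. The origin is a local minimum for $J$ with respect to a norm $\|\cdot\|_X$ ($X=\mathcal{C}^1$, $L^\infty$ or $W_0^{1,p}$) if there is $\rho>0$ such that $J(u)\ge J(0)$ for all $u\in W_0^{1,p}(\Omega)\cap X$ with $\|u\|_X<\rho$ (with $X=\mathcal{C}^1(\overline\Omega)$ in the first case, $X=L^\infty(\Omega)$ in the second). *)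

(* Defs.v *)
From HB Require Import structures.
From mathcomp Require Import all_boot all_order all_algebra.
From mathcomp Require Import all_classical all_reals all_analysis.

Set Implicit Arguments.
Unset Strict Implicit.
Unset Printing Implicit Defensive.
Import Order.TTheory GRing.Theory Num.Theory.
Import numFieldNormedType.Exports.
Local Open Scope classical_set_scope.
Local Open Scope ring_scope.

(* [R^n] is ['rV[R]_n] with the sigma-algebra generated by the coordinate
   functions, i.e. the Borel sigma-algebra. *)
Section measurable_rV.
Variables (R : realType) (n : nat).

Definition rv_coord (i : 'I_n) (x : 'rV[R]_n) : measurableTypeR R := x ord0 i.

Let rv_set0 : g_sigma_preimage rv_coord set0.
Proof. exact: sigma_algebra0. Qed.

Let rv_setC A : g_sigma_preimage rv_coord A ->
  g_sigma_preimage rv_coord (~` A).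
Proof. exact: sigma_algebraC. Qed.

Let rv_bigcup (F : (set 'rV[R]_n)^nat) :
  (forall i, g_sigma_preimage rv_coord (F i)) ->
  g_sigma_preimage rv_coord (\bigcup_i (F i)).
Proof. exact: sigma_algebra_bigcup. Qed.

HB.instance Definition _ :=
  @isMeasurable.Build (measure_tuple_display default_measure_display)
    'rV[R]_n (g_sigma_preimage rv_coord) rv_set0 rv_setC rv_bigcup.

Lemma measurable_rv_coord (i : 'I_n) : measurable_fun setT (rv_coord i).
Proof.
move=> _ Y mY; rewrite setTI; apply: sub_sigma_algebra => /=.
rewrite -bigcup_seq/=; exists i => /=; first by rewrite mem_index_enum.
by exists Y => //; rewrite setTI.
Qed.

Lemma measurable_fun_rvP d (T : measurableType d) (f : T -> 'rV[R]_n) :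
  (forall i, measurable_fun setT (rv_coord i \o f)) -> measurable_fun setT f.
Proof.
move=> mf _ A mA; rewrite setTI.
have sig : sigma_algebra setT [set B | d.-measurable (f @^-1` B)].
  split => [|B /= mB|F mF] /=.
  - by rewrite preimage_set0.
  - by rewrite setTD preimage_setC; exact: measurableC.
  - by rewrite preimage_bigcup; exact: bigcupT_measurable.
apply: (smallest_sub sig _ mA) => B; rewrite -bigcup_seq/= => -[i _ [Y mY <-]].
by rewrite setTI -comp_preimage -[X in measurable X]setTI; exact: mf.
Qed.

End measurable_rV.

Section lebesgue_rV.
Variable R : realType.

Definition rv_cons (n : nat) (x : measurableTypeR R * 'rV[R]_n) : 'rV[R]_n.+1 :=
  \row_i oapp (fun j => x.2 ord0 j) x.1 (unlift ord0 i).

Lemma measurable_rv_cons n : measurable_fun setT (@rv_cons n).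
Proof.
apply: measurable_fun_rvP => i.
case: (unliftP ord0 i) => [j|] ->.
  rewrite (_ : _ \o _ = @rv_coord R n j \o snd).
    by apply: measurableT_comp; [exact: measurable_rv_coord|].
  by apply/funext => x; rewrite /rv_coord/= mxE liftK.
rewrite (_ : _ \o _ = fst)//.
by apply/funext => x; rewrite /rv_coord/= mxE unlift_none.
Qed.

Definition rv_uncons (n : nat) (x : 'rV[R]_n.+1) : measurableTypeR R * 'rV[R]_n :=
  (x ord0 ord0, \row_j x ord0 (lift ord0 j)).

Lemma rv_consK n : cancel (@rv_cons n) (@rv_uncons n).
Proof.
move=> [x0 x]; rewrite /rv_uncons /rv_cons mxE unlift_none/=; congr pair.
by apply/rowP => j; rewrite !mxE liftK.
Qed.

Lemma measurable_rv_uncons n : measurable_fun setT (@rv_uncons n).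
Proof.
apply: measurable_fun_pair => /=.
  exact: (@measurable_rv_coord R n.+1 ord0).
apply: measurable_fun_rvP => i.
rewrite (_ : _ \o _ = @rv_coord R n.+1 (lift ord0 i)).
  exact: measurable_rv_coord.
by apply/funext => x; rewrite /rv_coord/= mxE.
Qed.

Section step.
Variables (n : nat) (m : {sigma_finite_measure set 'rV[R]_n -> \bar R}).

Definition lebesgue_rv_step : set 'rV[R]_n.+1 -> \bar R :=
  pushforward (@lebesgue_measure R \x m)%E (@rv_cons n).

Let step0 : lebesgue_rv_step set0 = 0%E.
Proof. by rewrite /lebesgue_rv_step /pushforward preimage_set0 measure0. Qed.

Let step_ge0 A : (0 <= lebesgue_rv_step A)%E.
Proof. by rewrite /lebesgue_rv_step /pushforward measure_ge0. Qed.

Let step_sigma_additive : semi_sigma_additive lebesgue_rv_step.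
Proof.
move=> F mF tF mUF; rewrite /lebesgue_rv_step /pushforward preimage_bigcup.
have mpre A : measurable A -> measurable (@rv_cons n @^-1` A).
  by move=> mA; rewrite -[X in measurable X]setTI; exact: measurable_rv_cons.
apply: measure_semi_sigma_additive.
- by move=> k; exact: mpre.
- apply/trivIsetP => /= i j _ _ ij; rewrite -preimage_setI.
  by move/trivIsetP : tF => /(_ _ _ _ _ ij) ->//; rewrite preimage_set0.
- by rewrite -preimage_bigcup; exact: mpre.
Qed.

HB.instance Definition _ := isMeasure.Build _ _ _ lebesgue_rv_step
  step0 step_ge0 step_sigma_additive.

Let step_sigma_finite : sigma_finite setT lebesgue_rv_step.
Proof.
have /sigma_finiteP[G [TG ndG Goo]] := sigma_finiteT m.
have /sigma_finiteP[F [TF ndF Foo]] :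
  sigma_finite setT (@lebesgue_measure R) by exact: sigma_finiteT.
have mpre A : measurable A -> measurable (@rv_uncons n @^-1` A).
  by move=> mA; rewrite -[X in measurable X]setTI; exact: measurable_rv_uncons.
exists (fun k => @rv_uncons n @^-1` (F k `*` G k)).
  rewrite -preimage_bigcup -[LHS](preimage_setT (@rv_uncons n)).
  congr (_ @^-1` _); rewrite -setXTT TF TG predeqE => -[x y]; split.
    move=> [/= [k _ Fkx] [l _ Gly]]; exists (maxn k l) => //; split.
    - by move: x Fkx; exact/subsetPset/ndF/leq_maxl.
    - by move: y Gly; exact/subsetPset/ndG/leq_maxr.
  by move=> [k _ []/= ? ?]; split; exists k.
move=> k; have [mF Fk] := Foo k; have [mG Gk] := Goo k; split.
  by apply: mpre; exact: measurableX.
rewrite /lebesgue_rv_step /pushforward -comp_preimage.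
rewrite (_ : _ \o _ = idfun); last by apply/funext => x; exact: rv_consK.
by rewrite preimage_id product_measure1E// lte_mul_pinfty// ge0_fin_numE.
Qed.

HB.instance Definition _ := Measure_isSigmaFinite.Build _ _ _ lebesgue_rv_step
  step_sigma_finite.

End step.

Fixpoint lebesgue_rv (n : nat) : {sigma_finite_measure set 'rV[R]_n -> \bar R} :=
  match n with
  | 0 => @dirac _ 'rV[R]_0 0 R
  | n'.+1 => lebesgue_rv_step (lebesgue_rv n')
  end.

Lemma lebesgue_rv_box n (a b : 'I_n -> R) : (forall i, a i <= b i) ->
  lebesgue_rv n [set x : 'rV[R]_n | forall i, x ord0 i \in `[a i, b i]] =
  (\prod_(i < n) (b i - a i))%:E.
Proof.
elim: n a b => [|n IH] a b ab.
  rewrite big_ord0 /= diracE mem_set//= => -[//].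
rewrite big_ord_recl EFinM -(IH (a \o lift ord0) (b \o lift ord0)); last first.
  by move=> i; exact: ab.
rewrite /= /lebesgue_rv_step /pushforward.
rewrite (_ : _ @^-1` _ = `[a ord0, b ord0]%classic `*`
    [set x : 'rV[R]_n | forall i, x ord0 i \in `[a (lift ord0 i), b (lift ord0 i)]]).
  rewrite product_measure1E//; last first.
    rewrite (_ : mkset _ = \bigcap_i (@rv_coord R n i @^-1`
        `[a (lift ord0 i), b (lift ord0 i)]%classic)).
      apply: fin_bigcap_measurable => // i _.
      by rewrite -[X in measurable X]setTI; exact: measurable_rv_coord.
    apply/seteqP; split=> x /= h i; first by move=> _; rewrite /= /rv_coord; exact: h.
    exact: (h i).
  congr (_ * _)%E.
  rewrite [LHS](lebesgue_measure_itv `[a ord0, b ord0])/= lte_fin.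
  have := ab ord0; rewrite le_eqVlt => /predU1P[->|->]; last by [].
  by rewrite ltxx subrr.
apply/seteqP; split => -[x0 x] /=.
  move=> h; split; first by have := h ord0; rewrite mxE unlift_none.
  by move=> i; have := h (lift ord0 i); rewrite mxE liftK.
move=> [h0 h] i; case: (unliftP ord0 i) => [j|] ->.
  by rewrite mxE liftK; exact: h.
by rewrite mxE unlift_none; exact: h0.
Qed.

End lebesgue_rV.

(* Functions are total on R^n; only their values on the open set [O] matter.
   Elements of L^p and Sobolev spaces are handled through Borel
   representatives. *)
Section function_spaces.
Variables (R : realType) (n : nat).
Local Notation V := 'rV[R]_n.
Local Notation mu := (lebesgue_rv R n).
Implicit Types (O : set V) (p : \bar R) (u : V -> R) (g : V -> V).

Definition bounded_domain O :=
  [/\ open O, connected O, O !=set0 & bounded_set O].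

Definition euclid_norm (v : V) : R := Num.sqrt (\sum_i v ord0 i ^+ 2).

Definition partial (i : 'I_n) u : V -> R := 'D_(delta_mx ord0 i) u.

Definition gradient u : V -> V := fun x => \row_i partial i u x.

Definition smooth u := forall s : seq 'I_n,
  continuous (foldr partial u s) /\
  forall i x, derivable (foldr partial u s) x (delta_mx ord0 i).

Definition test_function O u :=
  [/\ smooth u,
      compact (closure [set x : V | u x != 0]) &
      closure [set x : V | u x != 0] `<=` O].

Definition Lp_norm O p u : \bar R := 'N[mu]_p[(EFin \o u) \_ O]%E.

Definition Lp O p : set (V -> R) :=
  [set u | measurable_fun O u /\ (Lp_norm O p u < +oo)%E].

Definition weak_gradient O p u g :=
  (forall i, Lp O p (fun x => g x ord0 i)) /\
  forall phi i, test_function O phi ->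
    (\int[mu]_(x in O) (u x * partial i phi x) =
     - \int[mu]_(x in O) (g x ord0 i * phi x))%R.

Definition W1p O p : set (V -> R) :=
  [set u | Lp O p u /\ exists g, weak_gradient O p u g].

(* A weak gradient is unique almost everywhere on [O]; [wgrad] picks one. *)
Definition wgrad O p u : V -> V :=
  xget (fun=> 0) [set g : V -> V | weak_gradient O p u g].

(* The closure of the test functions in the W^{1,p} norm. *)
Definition W01p O p : set (V -> R) :=
  [set u | W1p O p u /\ exists phi : nat -> V -> R,
    [/\ forall k, test_function O (phi k),
        Lp_norm O p (fun x => phi k x - u x) @[k --> \oo] --> 0%E &
        forall i, Lp_norm O p
          (fun x => partial i (phi k) x - wgrad O p u x ord0 i)
          @[k --> \oo] --> 0%E]].

Definition W_norm O p u : \bar R :=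
  Lp_norm O p (fun x => euclid_norm (wgrad O p u x)).

Definition C1_closure O : set (V -> R) :=
  [set u | [/\ forall i x, O x -> derivable u x (delta_mx ord0 i),
    exists2 v : V -> R, {within closure O, continuous v} & {in O, u =1 v} &
    forall i, exists2 v : V -> R,
      {within closure O, continuous v} & {in O, partial i u =1 v}]].

Definition C1_norm O u : \bar R :=
  (ereal_sup [set `|u x|%:E | x in O] +
   ereal_sup [set (euclid_norm (gradient u x))%:E | x in O])%E.

End function_spaces.

Section energy.
Variable R : realType.
Local Notation lambda := (@lebesgue_measure R).

(* Measurability for the completed measure: a.e. equality with a Borel
   function. *)
Definition ae_measurable d (T : measurableType d) (m : {measure set T -> \bar R})
    (D : set T) (h : T -> R) :=
  exists2 h0 : T -> R, measurable_fun D h0 &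
    {ae m, forall x, D x -> h x = h0 x}.

Definition locally_integrable_R (h : R -> R) :=
  ae_measurable lambda setT h /\
  forall a : R, (\int[lambda]_(s in `[(- a)%R, a]) `|h s|%:E < +oo)%E.

Definition oriented_integral (h : R -> R) (v : R) : R :=
  if 0 <= v then \int[lambda]_(s in `[0, v]) h s
  else - \int[lambda]_(s in `[v, 0]) h s.

Definition Mhat (M : R -> R) (t : R) : R := \int[lambda]_(s in `[0, t]) M s.

Section Rn.
Variable n : nat.
Local Notation V := 'rV[R]_n.

Definition primitive (f : V -> R -> R) (x : V) (v : R) : R :=
  oriented_integral (f x) v.

Definition caratheodory (O : set V) (F : V -> R -> R) :=
  (forall v, ae_measurable (lebesgue_rv R n) O (F ^~ v)) /\
  {ae lebesgue_rv R n, forall x, O x -> continuous (F x)}.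

(* Extended-real valued: the growth condition bounds [F] from above only, so
   that the integral may be [-oo]. *)
Definition J (O : set V) (p : R) (M : R -> R) (f : V -> R -> R)
    (u : V -> R) : \bar R :=
  ((p^-1 * Mhat M (fine (W_norm O p%:E u) `^ p))%:E -
   \int[lebesgue_rv R n]_(x in O) (primitive f x (u x))%:E)%E.

Definition local_min_origin (W X : set (V -> R)) (nrm : (V -> R) -> \bar R)
    (j : (V -> R) -> \bar R) :=
  exists2 rho : R, 0 < rho &
    forall u, W u -> X u -> (nrm u < rho%:E)%E -> (j (fun=> 0%R) <= j u)%E.

Definition local_min_C1 O (p : R) j :=
  local_min_origin (W01p O p%:E) (C1_closure O) (C1_norm O) j.

Definition local_min_Loo O (p : R) j :=
  local_min_origin (W01p O p%:E) (Lp O +oo%E) (Lp_norm O +oo%E) j.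

Definition local_min_W O (p : R) j :=
  local_min_origin (W01p O p%:E) (W01p O p%:E) (W_norm O p%:E) j.

End Rn.
End energy.

(* Main.v *)
Require Import Defs.
From HB Require Import structures.
From mathcomp Require Import all_boot all_order all_algebra.
From mathcomp Require Import ring lra.
From mathcomp Require Import all_classical all_reals all_analysis.
From mathcomp Require Import measurable_realfun ess_sup_inf.
Import Order.TTheory GRing.Theory Num.Theory.
Import HBSimple HBNNSimple.
Import numFieldNormedType.Exports.
Local Open Scope classical_set_scope.
Local Open Scope ring_scope.

(** Let phi be a fixed smooth bump supported in the cube [-1,1]^n and, for a centre
    c in Omega, put u_e(x) = e^(-a) phi((x - c) / e). Counting powers of e,

      |u_e|_W ~ e^s with s = n/p - 1 - a,
      int u_e^varpi ~ e^(n - a varpi),   int u_e^q ~ e^(n - a q),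

    so that, by (i) and (ii),

      J(u_e) <= C e^(s r) - C' e^(n - a varpi) + C'' e^(n - a q).

    The middle term wins as e -> 0 provided n - a varpi < n - a q, which holds
    since q < varpi and a > 0, and n - a varpi < s r, which holds for every small
    a > 0 because r > p^* says exactly that (n/p - 1) r > n. A small positive a
    therefore serves all exponents varpi at once, the critical one included.
    No change of variables is needed: the three powers follow from sup bounds for
    u_e and its gradient and from the volumes of two cubes ([spike_energy_lt],
    [exists_small_negative_energy]).

    The other claims are sign considerations. Where F(x,u(x)) <= 0 almost
    everywhere and Mhat(|u|_W^p) >= 0, J(u) >= 0 = J(0) ([J_ge0]). By
    (iv) a small L^oo norm gives the first condition; a small C^1 norm gives both,
    by (iii) and (iv), since it also bounds the gradient. The functions u_e refute
    minimality in W.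

    What makes these lines rigorous is that the W-norm is computed from a weak
    gradient picked by choice, so it has to be identified with the classical
    gradient: for u_e, for functions that are C^1 up to the boundary, and even for
    u = 0 (to get J(0) = 0). That takes two facts. First, the classical gradient
    is a weak gradient ([integration_by_parts]); by induction on the dimension
    and Fubini's theorem it reduces to the one-dimensional fundamental theorem of
    calculus ([integral_partial_eq0]). Second, weak gradients are unique almost
    everywhere ([weak_gradient_unique]), by the fundamental lemma of the calculus
    of variations ([fundamental_lemma_variations]). For the latter, indicators of
    boxes are bounded pointwise limits of products of one-dimensional bumps, so a
    function orthogonal to all test functions has zero integral on every box, and
    hence, boxes being a generating pi-system, on every measurable set. *)

(** * Comparing integrals of arbitrary functions *)
Section MonotoneIntegral.
Context {d : measure_display} {T : measurableType d} {R : realType}.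
Variable mu : {measure set T -> \bar R}.
Implicit Types (D : set T) (f g : T -> \bar R).
Local Open Scope ereal_scope.

(** The integral of a nonnegative function is a supremum over the simple
    functions below it, so it is monotone whether or not the functions are
    measurable; a simple function can be cut off on the exceptional null set
    without changing its integral. This lets the integral of F(x, u(x)) be
    compared with explicit integrals. *)
Lemma ge0_ae_le_integral_nonmeas f g :
  (forall x, 0 <= f x) -> (forall x, 0 <= g x) ->
  {ae mu, forall x, f x <= g x} ->
  \int[mu]_x f x <= \int[mu]_x g x.
Proof.
move=> f0 g0 [Z [mZ Z0 fgZ]].
rewrite !ge0_integralTE//.
apply: ge_ereal_sup => _ [h hf <-].
have mZC : measurable (~` Z) by exact: measurableC.
pose h' := proj_nnsfun h mZC.
have -> : sintegral mu h = sintegral mu h'.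
  rewrite -!integralT_nnsfun; apply: ae_eq_integral => //.
  - exact/measurable_EFinP.
  - exact/measurable_EFinP.
  exists Z; split => // x /= nx; apply: contrapT => Zx; apply: nx => _.
  by rewrite /h' /= /mindic indicE mem_set ?mulr1.
apply: ereal_sup_ubound; exists h' => //= x.
rewrite /= /mindic indicE; case: (pselect (Z x)) => Zx.
  by rewrite memNset ?mulr0//; apply.
rewrite mem_set// mulr1; apply: (le_trans (hf x)).
by apply: contrapT => h1; apply: Zx; apply: fgZ.
Qed.

Lemma ae_le_integral_nonmeas D f g : {ae mu, forall x, D x -> f x <= g x} ->
  \int[mu]_(x in D) f x <= \int[mu]_(x in D) g x.
Proof.
move=> fg; rewrite (integral_mkcond D f) (integral_mkcond D g).
have {fg} : {ae mu, forall x, (f \_ D) x <= (g \_ D) x}.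
  apply: filterS fg => x fg; rewrite !patchE; case: ifPn => // xD.
  by apply: fg; rewrite inE in xD.
move: (f \_ D) (g \_ D) => {}f {}g fg.
rewrite [leLHS]integralE [leRHS]integralE; apply: leeB;
  apply: ge0_ae_le_integral_nonmeas => //; apply: filterS fg => x fg.
- by apply: (@funepos_le _ _ [set x]); rewrite ?inE// => y; rewrite inE => ->.
- by apply: (@funeneg_le _ _ [set x]); rewrite ?inE// => y; rewrite inE => ->.
Qed.

Lemma le_integral_nonmeas D f g : (forall x, D x -> f x <= g x) ->
  \int[mu]_(x in D) f x <= \int[mu]_(x in D) g x.
Proof. by move=> fg; apply: ae_le_integral_nonmeas; exact/aeW. Qed.

Lemma ae_eq_integral_nonmeas D f g : {ae mu, forall x, D x -> f x = g x} ->
  \int[mu]_(x in D) f x = \int[mu]_(x in D) g x.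
Proof.
by move=> fg; apply/eqP; rewrite eq_le; apply/andP; split;
  apply: ae_le_integral_nonmeas; apply: filterS fg => x fg Dx; rewrite fg.
Qed.

End MonotoneIntegral.

(** * Smooth bumps on the line *)
Section SmoothLine.
Context {R : realType}.
Implicit Types (f g : R -> R) (n : nat).

(** Recursion on the derivative makes closure under sums and products an
    induction with one application of the derivation rules per step. *)
Fixpoint Cn n f : Prop :=
  match n with
  | 0 => continuous f
  | n'.+1 => (forall x, derivable f x 1) /\ Cn n' (derive1 f)
  end.

Definition smooth1 f := forall n, Cn n f.

Lemma eq_Cn n f g : f =1 g -> Cn n f -> Cn n g.
Proof. by move=> /funext ->. Qed.

Lemma Cn_cont n f : Cn n f -> continuous f.
Proof.
case: n => [//|n] [df _] x.
by apply/differentiable_continuous/derivable1_diffP.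
Qed.

Lemma CnW n f : Cn n.+1 f -> Cn n f.
Proof.
elim: n f => [|n IH] f; first exact: (@Cn_cont 1).
by move=> [df Cf]; split => //; exact: IH.
Qed.

Lemma Cn_is_derive n f f' : (forall x : R, is_derive x 1 f (f' x)) ->
  Cn n f' -> Cn n.+1 f.
Proof.
move=> df Cf'; split=> [x|]; first by have [] := df x.
by apply: eq_Cn Cf' => x; rewrite derive1E; have [_ ->] := df x.
Qed.

Lemma Cn_deriv n f (x : R) : Cn n.+1 f -> is_derive x 1 f (derive1 f x).
Proof. by move=> [df _]; rewrite derive1E; apply/derivableP. Qed.

Lemma Cn_cst n (c : R) : Cn n (cst c).
Proof.
elim: n c => [|n IH] c; first exact: cst_continuous.
by apply: (@Cn_is_derive _ _ (cst 0)).
Qed.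

Lemma CnD n f g : Cn n f -> Cn n g -> Cn n (fun x => f x + g x).
Proof.
elim: n f g => [|n IH] f g cf cg; first by move=> x; exact: (cvgD (cf x) (cg x)).
apply: (@Cn_is_derive _ (fun x => f x + g x) (fun x => derive1 f x + derive1 g x)).
  move=> x; have df := Cn_deriv _ _ x cf; have dg := Cn_deriv _ _ x cg.
  exact: is_deriveD.
by apply: IH; [case: cf|case: cg].
Qed.

Lemma CnM n f g : Cn n f -> Cn n g -> Cn n (fun x => f x * g x).
Proof.
elim: n f g => [|n IH] f g cf cg; first by move=> x; exact: (cvgM (cf x) (cg x)).
apply: (@Cn_is_derive _ (fun x => f x * g x)
  (fun x => f x * derive1 g x + g x * derive1 f x)).
  move=> x; have df := Cn_deriv _ _ x cf; have dg := Cn_deriv _ _ x cg.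
  exact: is_deriveM.
by apply: CnD; apply: IH; [exact: CnW|case: cg|exact: CnW|case: cf].
Qed.

Lemma Cn_affine n f (a b : R) : Cn n f -> Cn n (fun x => f (a * x + b)).
Proof.
elim: n f => [|n IH] f cf.
  move=> x; apply: (@continuous_comp _ _ _ (fun x : R => a * x + b) f).
    by apply: cvgD; [apply: cvgM; [exact: cvg_cst|exact: cvg_id]|exact: cvg_cst].
  exact: cf.
apply: (@Cn_is_derive _ _ (fun x => derive1 f (a * x + b) * a)).
  move=> x; have df := Cn_deriv _ _ (a * x + b) cf.
  have dg : is_derive x 1 (fun x => a * x + b) a.
    by apply: is_derive_eq; rewrite ?scaler0 ?add0r ?addr0 /GRing.scale/= ?mulr1.
  exact: is_derive1_comp.
by apply: CnM; [apply: IH; case: cf|exact: Cn_cst].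
Qed.

Lemma smooth1_deriv f : smooth1 f -> smooth1 (derive1 f).
Proof. by move=> sf n; case: (sf n.+1). Qed.

Lemma smooth1_is_derive f (x : R) : smooth1 f -> is_derive x 1 f (derive1 f x).
Proof. by move=> sf; apply: (@Cn_deriv 0). Qed.

(** The factor t^-n is there to have a family closed under differentiation:
    all derivatives of exp(-1/t) are combinations of its members. *)
Definition flat n (t : R) : R := if 0 < t then t^-1 ^+ n * expR (- t^-1) else 0.

Lemma flat_ge0 n t : 0 <= flat n t.
Proof.
rewrite /flat; case: ifPn => // t0.
by rewrite mulr_ge0 ?expR_ge0// exprn_ge0// invr_ge0 ltW.
Qed.

(** With y = 1/t this is y^n <= n! e^y, one term of the exponential series. *)
Lemma flat_bound n t : flat n t <= n`!%:R.
Proof.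
case: n => [|n]; rewrite /flat; case: ifPn => t0 //.
  by rewrite expr0 mul1r fact0 expR_le1 oppr_le0 invr_ge0 ltW.
have s0 : 0 < t^-1 by rewrite invr_gt0.
rewrite expRN ler_pdivrMr ?expR_gt0//.
have h := @expR_ge1Dxn R t^-1 n (ltW s0).
have F0 : 0 < n.+1`!%:R :> R by rewrite ltr0n fact_gt0.
have {}h : t^-1 ^+ n.+1 / n.+1`!%:R <= expR t^-1.
  by apply: le_trans h; rewrite lerDr.
by rewrite ler_pdivrMr// mulrC in h.
Qed.

Lemma flat_S n t : flat n t = t * flat n.+1 t.
Proof.
rewrite /flat; case: ifPn => t0; last by rewrite mulr0.
by rewrite mulrA exprS mulrA divff ?mul1r// gt_eqF.
Qed.

Lemma flat_le n t : flat n t <= n.+1`!%:R * `|t|.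
Proof.
rewrite flat_S; apply: (@le_trans _ _ (`|t| * flat n.+1 t)).
  by rewrite ler_wpM2r ?flat_ge0// ler_norm.
by rewrite mulrC ler_wpM2r// flat_bound.
Qed.

Lemma flat_cvg0 n : flat n t @[t --> (0:R)] --> (0:R).
Proof.
apply: (@squeeze_cvgr _ _ _ _ (fun=> 0) (fun t : R => n.+1`!%:R * `|t|)).
- by apply: nearW => t; rewrite flat_ge0 flat_le.
- exact: cvg_cst.
suff : (n.+1`!%:R * `|t|) @[t --> (0:R)] --> (n.+1`!%:R * `|0:R|).
  by rewrite normr0 mulr0.
by apply: cvgMl_tmp; apply: cvg_norm; exact: cvg_id.
Qed.

(** At t = 0 the difference quotient of [flat n] is [flat n.+1], which tends
    to 0. *)
Lemma flat_is_derive n (t : R) :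
  is_derive t 1 (flat n) (flat n.+2 t - n%:R * flat n.+1 t).
Proof.
have [t0|t0|->] := ltgtP t 0.
- apply: (@near_eq_is_derive _ _ _ (cst 0)).
    near=> s; rewrite /flat ltNge (_ : s <= 0)//.
    by near: s; apply: filterS (lt_nbhsl t0) => s; exact: ltW.
  rewrite /flat ltNge (ltW t0) /= mulr0 subr0; exact: is_derive_cst.
- have tn0 : t != 0 by rewrite gt_eqF.
  have d0 : is_derive t 1 (fun s : R => s) 1 by exact: is_derive_id.
  have d1 : is_derive t 1 (fun s : R => s^-1) (- t ^- 2 *: 1).
    exact: (@is_deriveV _ _ _ _ _ tn0 d0).
  have d2 := @is_deriveX _ _ _ n _ _ _ d1.
  have d3 := @is_deriveN _ _ _ _ _ _ _ d1.
  have d4 := @is_derive1_comp _ expR _ _ _ _ (is_derive_expR _) d3.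
  have d5 := @is_deriveM _ _ _ _ _ _ _ _ d2 d4.
  have d6 := @near_eq_is_derive _ _ _ _ (flat n) _ _ _ _ d5.
  have tpos : \forall s \near t, (0:R) < s.
    exact: (@cvgr_gt _ _ (nbhs t) _ id t cvg_id 0 t0).
  refine (@is_derive_eq _ _ _ _ _ _ _ _ (d6 _) _).
    by apply: filterS tpos => s s0; rewrite /flat s0 !fctE.
  rewrite /flat t0 !fctE /GRing.scale /= !mulr1.
  case: (n) => [|m]; rewrite /= ?exprS ?expr0.
    by field.
  by move: (_ ^+ m) (expR _) m.+1%:R => u v w; field.
have dq : h^-1 *: ((flat n \o shift 0) (h *: (1:R)) - flat n 0) @[h --> 0^'] --> (0:R).
  apply: (@cvg_trans _ (flat n.+1 h @[h --> (0:R)^'])); last first.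
    by apply: cvg_trans (flat_cvg0 n.+1); apply: cvg_app; exact: cvg_within.
  apply: near_eq_cvg; near=> h.
  have h0 : h != 0 by near: h; exact: nbhs_dnbhs_neq.
  rewrite /= addr0 /GRing.scale /= mulr1 (flat_S n h) (_ : flat n 0 = 0); last first.
    by rewrite /flat ltxx.
  by rewrite subr0 mulrA mulVf// mul1r.
have -> : flat n.+2 0 - n%:R * flat n.+1 0 = 0.
  by rewrite /flat ltxx mulr0 subr0.
split; first by apply/cvg_ex; exists 0.
exact: cvg_lim dq.
Unshelve. all: by end_near.
Qed.

Lemma Cn_flat m n : Cn m (flat n).
Proof.
elim: m n => [|m IH] n.
  by move=> x; apply/differentiable_continuous/derivable1_diffP; case: (flat_is_derive n x).
apply: Cn_is_derive (flat_is_derive n) _.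
by apply: (@eq_Cn _ (fun t => flat n.+2 t + (- n%:R) * flat n.+1 t)) => [t|];
  [rewrite mulNr|apply: CnD => //; apply: CnM => //; exact: Cn_cst].
Qed.

(** For k > 0, positive exactly on the open interval from a to b; increasing k
    steepens the two flanks, so that the limit is the indicator. *)
Definition bump_itv (k a b : R) (t : R) : R := flat 0 (k * (t - a)) * flat 0 (k * (b - t)).

Lemma smooth1_bump_itv k a b : smooth1 (bump_itv k a b).
Proof.
move=> n; apply: CnM.
  apply: (@eq_Cn _ (fun t => flat 0 (k * t + - (k * a)))) => [t|].
    by rewrite mulrBr.
  exact/Cn_affine/Cn_flat.
apply: (@eq_Cn _ (fun t => flat 0 (- k * t + (k * b)))) => [t|].
  by rewrite mulrBr mulNr addrC.
exact/Cn_affine/Cn_flat.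
Qed.

Lemma flat0_le1 t : flat 0 t <= 1.
Proof. exact: (flat_bound 0). Qed.

Lemma bump_itv_ge0 k a b t : 0 <= bump_itv k a b t.
Proof. by rewrite mulr_ge0 ?flat_ge0. Qed.

Lemma bump_itv_le1 k a b t : bump_itv k a b t <= 1.
Proof. by rewrite mulr_ile1 ?flat_ge0 ?flat0_le1. Qed.

Lemma bump_itv_out k a b t : 0 < k -> t \notin `]a, b[ -> bump_itv k a b t = 0.
Proof.
rewrite in_itv/= negb_and -!leNgt /bump_itv /flat => k0 /orP[ta|bt].
  by rewrite ltNge mulr_ge0_le0 ?mul0r ?subr_le0// ltW.
by rewrite mulrC ltNge mulr_ge0_le0 ?mul0r ?subr_le0// ltW.
Qed.

Lemma bump_itv_cvg a b t :
  bump_itv n.+1%:R a b t @[n --> \oo] --> (if t \in `]a, b[ then 1 else 0 : R).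
Proof.
case: ifPn => tab; last first.
  by under eq_cvg do rewrite bump_itv_out//; exact: cvg_cst.
move: tab; rewrite in_itv/= => /andP[at_ tb].
have fc (s : R) : 0 < s -> flat 0 (n.+1%:R * s) @[n --> \oo] --> (1 : R).
  move=> s0.
  apply: (@cvg_trans _ (expR (- (s^-1 * n.+1%:R^-1)) @[n --> \oo])).
    apply: near_eq_cvg; apply: nearW => n /=.
    by rewrite /flat mulr_gt0// expr0 mul1r invfM mulrC.
  suff : expR (- (s^-1 * n.+1%:R^-1)) @[n --> \oo] --> expR (- (s^-1 * 0)).
    by rewrite mulr0 oppr0 expR0.
  apply: continuous_cvg; first exact: continuous_expR.
  by apply: cvgN; apply: cvgMl_tmp; exact: cvg_harmonic.
rewrite -[X in _ --> X](mulr1 (1:R)).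
by apply: cvgM; apply: fc; rewrite subr_gt0.
Qed.

End SmoothLine.

(** * Boxes, open sets and the Borel structure of R^n *)
Section Boxes.
Context {R : realType} {n : nat}.
Local Notation V := 'rV[R]_n.
Local Notation mu := (lebesgue_rv R n).
Implicit Types (a b : 'I_n -> R) (O U : set V).

Definition obox a b : set V := [set x | forall i, x ord0 i \in `]a i, b i[].
Definition cbox a b : set V := [set x | forall i, x ord0 i \in `[a i, b i]].

Lemma obox_cbox a b : obox a b `<=` cbox a b.
Proof. by move=> x xo i; apply: subset_itv_oo_cc; exact: xo. Qed.

Lemma oboxI a b a' b' :
  obox a b `&` obox a' b' =
  obox (fun i => Num.max (a i) (a' i)) (fun i => Num.min (b i) (b' i)).
Proof.
apply/seteqP; split => [x [h h'] i|x h].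
  have := h i; have := h' i; rewrite !in_itv/= gt_max lt_min => /andP[-> ->].
  by move=> /andP[-> ->].
by split=> i; have := h i; rewrite !in_itv/= gt_max lt_min =>
  /andP[/andP[? ?] /andP[? ?]]; apply/andP.
Qed.

Lemma measurable_coord_itv (I : 'I_n -> interval R) :
  measurable [set x : V | forall i, x ord0 i \in I i].
Proof.
rewrite (_ : mkset _ = \bigcap_i (@rv_coord R n i @^-1` [set` I i])).
  apply: fin_bigcap_measurable => // i _.
  by rewrite -[X in measurable X]setTI; exact: measurable_rv_coord.
by apply/seteqP; split=> x /= h i; [move=> _; exact: h|exact: (h i)].
Qed.

Lemma measurable_obox a b : measurable (obox a b).
Proof. exact: measurable_coord_itv. Qed.

Lemma measurable_cbox a b : measurable (cbox a b).
Proof. exact: measurable_coord_itv. Qed.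

Lemma cbox_lty a b : (mu (cbox a b) < +oo)%E.
Proof.
case: (pselect (forall i, a i <= b i)) => [ab|/existsNP[i /negP nab]].
  by rewrite /cbox lebesgue_rv_box// ltry.
rewrite (_ : cbox a b = set0) ?measure0// -subset0 => x /(_ i).
by rewrite in_itv/= => /andP[/le_trans] /[apply]; exact/negP.
Qed.

Lemma compact_cbox a b : compact (cbox a b).
Proof.
apply: (@rV_compact R n (fun i => `[a i, b i]%classic)) => i.
exact: segment_compact.
Qed.

Lemma ball_coord (x y : V) e : 0 < e ->
  ball x e y <-> forall i, `|x ord0 i - y ord0 i| < e.
Proof.
move=> e0; split=> [[_ h] i|h].
  by have := h ord0 i.
split => // i j; rewrite ord1; exact: h.
Qed.

(** Around each point there is room for a box with rational corners. The closed
    boxes stay inside [U], so that each open box of the cover carries test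
    functions supported in [U]. *)
Lemma open_bigcup_obox U : open U -> exists B : nat -> set V,
  (forall k, B k = set0 \/ exists a b, B k = obox a b /\ cbox a b `<=` U) /\
  U = \bigcup_k B k.
Proof.
move=> oU.
pose I := {ffun 'I_n -> rat * rat}.
pose A (ab : I) (i : 'I_n) : R := ratr (ab i).1.
pose A' (ab : I) (i : 'I_n) : R := ratr (ab i).2.
(* Codes of boxes that are not contained in [U] are sent to the empty set. *)
pose B k := if unpickle k is Some ab then
  if `[< cbox (A ab) (A' ab) `<=` U >] then obox (A ab) (A' ab) else set0 else set0.
exists B; split=> [k|].
  rewrite /B; case: unpickle => [ab|]; last by left.
  by case: asboolP => h; [right; exists (A ab), (A' ab)|left].
apply/seteqP; split=> [x Ux|x [k _]]; last first.
  rewrite /B; case: unpickle => [ab|//]; case: asboolP => // h /obox_cbox; exact: h.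
have /nbhs_ballP[e /= e0 xeU] : nbhs x U by exact: open_nbhs_nbhs.
have qx i : exists q : rat * rat, (ratr q.1 \in `](x ord0 i - e), (x ord0 i)[) /\
   (ratr q.2 \in `](x ord0 i), (x ord0 i + e)[).
  have /rat_in_itvoo[q hq] : x ord0 i - e < x ord0 i by rewrite ltrBlDr ltrDl.
  have /rat_in_itvoo[q' hq'] : x ord0 i < x ord0 i + e by rewrite ltrDl.
  by exists (q, q').
have [q hq] := choice qx.
exists (pickle ([ffun i => q i] : I)) => //.
rewrite /B pickleK; case: asboolP => [_ i|].
  rewrite /A /A' ffunE; have [] := hq i; rewrite !in_itv/=.
  by move=> /andP[_ ->] /andP[->].
apply: contra_notP => _ y hy; apply: xeU; apply/ball_coord => // i.
have [] := hq i; have := hy i; rewrite /A /A' ffunE !in_itv/=.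
move=> /andP[h1 h2] /andP[h3 h4] /andP[h5 h6].
rewrite ltr_norml; apply/andP; split; lra.
Qed.

Lemma measurable_open U : open U -> measurable U.
Proof.
move=> /open_bigcup_obox[B [hB ->]]; apply: bigcupT_measurable => k.
by have [->|[a [b [-> _]]]] := hB k; [exact: measurable0|exact: measurable_obox].
Qed.

Definition oboxes : set (set V) := [set A | exists a b, A = obox a b].

Lemma setI_closed_oboxes : setI_closed oboxes.
Proof.
move=> _ _ [a [b ->]] [a' [b' ->]]; rewrite oboxI.
by eexists; eexists; reflexivity.
Qed.

Lemma measurable_rV_oboxes : @measurable _ V = <<s oboxes >>.
Proof.
apply/seteqP; split; last first.
  apply: smallest_sub; first exact: sigma_algebra_measurable.
  by move=> _ [a [b ->]]; exact: measurable_obox.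
have sG := @smallest_sigma_algebra _ setT oboxes.
have openG U : open U -> <<s oboxes >> U.
  move=> /open_bigcup_obox[B [hB ->]].
  apply: sigma_algebra_bigcup => k.
  have [->|[a [b [-> _]]]] := hB k; first exact: sigma_algebra0.
  by apply: sub_sigma_algebra; exists a, b.
apply: smallest_sub => // A; rewrite -bigcup_seq => -[i _ [Y mY <-]].
rewrite setTI.
suff sub : (RGenOpens.G (R:=R)).-sigma.-measurable `<=`
    [set Y | <<s oboxes >> (@rv_coord R n i @^-1` Y)].
  by apply: sub; rewrite -RGenOpens.measurableE.
apply: smallest_sub.
  split => [|B /= mB|F mF] /=.
  - by rewrite preimage_set0; exact: sigma_algebra0.
  - by rewrite setTD preimage_setC -setTD; exact: sigma_algebraCD.
  - by rewrite preimage_bigcup; exact: sigma_algebra_bigcup.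
move=> Z [z1 [z2 ->]] /=.
have co : continuous (@rv_coord R n i) by move=> x; exact: coord_continuous.
by apply: openG; move/continuousP : co; apply; exact: interval_open.
Qed.

Lemma measurable_continuous O (f : V -> R) : open O ->
  (forall x, O x -> {for x, continuous f}) -> measurable_fun O f.
Proof.
move=> oO cf; apply: (measurability _ (RGenOInfty.measurableE R)) => //.
move=> _ [_ [r ->] <-]; apply: measurable_open; rewrite openE => x [Ox /= fx].
rewrite /interior; near=> y; split; first by near: y; exact: open_nbhs_nbhs.
near: y; apply: (cf _ Ox); apply: open_nbhs_nbhs; split => //.
Unshelve. all: by end_near.
Qed.

Lemma bounded_cbox O : bounded_set O ->
  exists2 K, 0 < K & O `<=` cbox (fun=> - K) (fun=> K).
Proof.
move=> [M [_ hM]]; exists (`|M| + 2); first by rewrite ltr_wpDl.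
move=> x Ox i.
have M1 : M < `|M| + 1 by rewrite (le_lt_trans (ler_norm _))// ltrDl.
have /= xM := hM _ M1 x Ox.
have : ball (0 : V) (`|M| + 2) x.
  by rewrite mx_norm_ball /ball_ /= sub0r normrN; lra.
have M2 : 0 < `|M| + 2 by rewrite ltr_wpDl.
move=> /(ball_coord _ _ _ M2)/(_ i); rewrite mxE sub0r normrN => /ltW.
by rewrite ler_norml in_itv.
Qed.

End Boxes.

(** * The integral of a partial derivative vanishes *)
Section IntegralDerivative.
Context {R : realType}.
Local Notation lambda := (@lebesgue_measure R).

(** Directional derivatives only see the restriction of a function to a line;
    this transports them between R^n, its coordinate lines and its slices. *)
Lemma is_derive_of_quotient {V W : normedModType R} (f : V -> R) (g : W -> R) x v y w l :
  (forall h : R, f (h *: v + x) = g (h *: w + y)) ->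
  is_derive x v f l -> is_derive y w g l.
Proof.
move=> fg [df dfE].
have E : (fun h : R => h^-1 *: ((g \o shift y) (h *: w) - g y)) =
         (fun h : R => h^-1 *: ((f \o shift x) (h *: v) - f x)).
  apply/funext => h /=; rewrite fg; congr (_ *: (_ - _)).
  by have := fg 0; rewrite !scale0r !add0r => ->.
by split; rewrite /derivable /derive E.
Qed.

Lemma integral_derive_eq0 (w w' : R -> R) (K : R) : 0 < K ->
  continuous w' -> (forall t : R, is_derive t 1 w (w' t)) ->
  (forall t, K <= `|t| -> w t = 0) -> (forall t, K <= `|t| -> w' t = 0) ->
  (\int[lambda]_t (w' t)%:E = 0)%E.
Proof.
move=> K0 cw' dw w0 w'0.
have -> : (fun t => (w' t)%:E) = (fun t => (w' t)%:E) \_ `[- K, K].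
  apply/funext => t; rewrite patchE; case: ifPn => //.
  rewrite notin_setE /= in_itv/= => /negP; rewrite -ler_norml -ltNge => /ltW Kt.
  by rewrite w'0.
rewrite -integral_mkcond.
have cw : continuous w.
  by move=> t; apply/differentiable_continuous/derivable1_diffP; case: (dw t).
rewrite (@continuous_FTC2 _ w' w).
- by rewrite !w0 ?subee// ?normrN ler_norm.
- by rewrite gtrN.
- exact: continuous_subspaceT.
- split.
  + by move=> t _; case: (dw t).
  + by apply: cvg_at_right_filter; exact: cw.
  + by apply: cvg_at_left_filter; exact: cw.
- by move=> t _; rewrite derive1E; case: (dw t).
Qed.

Lemma continuous_rV {T : topologicalType} {n} (f : T -> 'rV[R]_n) :
  (forall i, continuous (fun t => f t ord0 i)) -> continuous f.
Proof.
move=> cf t; apply/cvg_ballP => e e0.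
have : \forall s \near t, forall i, `|f t ord0 i - f s ord0 i| < e.
  apply: filter_forall => i.
  by have /cvgrPdist_lt := cf i t; apply.
by apply: filterS => s h; apply/ball_coord.
Qed.

Lemma continuous_coord {n} (i : 'I_n) : continuous (fun x : 'rV[R]_n => x ord0 i).
Proof. by move=> x; exact: coord_continuous. Qed.

Lemma rv_cons_ord0 {n} x0 (y : 'rV[R]_n) : rv_cons (x0, y) ord0 ord0 = x0.
Proof. by rewrite mxE unlift_none. Qed.

Lemma rv_cons_lift {n} x0 (y : 'rV[R]_n) j : rv_cons (x0, y) ord0 (lift ord0 j) = y ord0 j.
Proof. by rewrite mxE liftK. Qed.

Lemma rv_cons_line0 {n} (h x0 : R) (y : 'rV[R]_n) :
  h *: delta_mx ord0 ord0 + rv_cons (x0, y) = rv_cons (h + x0, y).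
Proof.
apply/rowP => i; rewrite 2!mxE.
case: (unliftP ord0 i) => [j|] ->; rewrite ?rv_cons_lift ?rv_cons_ord0 !mxE eqxx /=.
  by rewrite mulr0 add0r.
by rewrite mulr1.
Qed.

Lemma rv_cons_lineS {n} (h x0 : R) (y : 'rV[R]_n) (j : 'I_n) :
  h *: delta_mx ord0 (lift ord0 j) + rv_cons (x0, y) =
  rv_cons (x0, h *: delta_mx ord0 j + y).
Proof.
apply/rowP => i; rewrite 2!mxE.
case: (unliftP ord0 i) => [k|] ->; rewrite ?rv_cons_lift ?rv_cons_ord0 !mxE eqxx /=.
  by rewrite (inj_eq lift_inj).
by rewrite mulr0 add0r.
Qed.

Lemma continuous_rv_cons_l {n} (y : 'rV[R]_n) : continuous (fun x0 : R => rv_cons (x0, y)).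
Proof.
apply: continuous_rV => i; case: (unliftP ord0 i) => [j|] ->.
  by under eq_fun do rewrite rv_cons_lift; exact: cst_continuous.
by under eq_fun do rewrite rv_cons_ord0; move=> x; exact: cvg_id.
Qed.

Lemma continuous_rv_cons_r {n} (x0 : R) : continuous (fun y : 'rV[R]_n => rv_cons (x0, y)).
Proof.
apply: continuous_rV => i; case: (unliftP ord0 i) => [j|] ->.
  by under eq_fun do rewrite rv_cons_lift; exact: continuous_coord.
by under eq_fun do rewrite rv_cons_ord0; exact: cst_continuous.
Qed.

Definition vanishes_outside {n} (K : R) (w : 'rV[R]_n -> R) :=
  forall x : 'rV[R]_n, (exists j, K <= `|x ord0 j|) -> w x = 0.

Lemma continuous_bounded_cbox {n} (f : 'rV[R]_n -> R) a b : continuous f ->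
  [bounded f x | x in cbox a b].
Proof.
move=> cf; have : compact (f @` cbox a b).
  by apply: continuous_compact; [exact: continuous_subspaceT|exact: compact_cbox].
move=> /compact_bounded; rewrite /bounded_set /bounded_near; apply: filterS => M fM x xab.
by apply: fM; exists x.
Qed.

Lemma integrable_vanishes {n} (f : 'rV[R]_n -> R) K : continuous f ->
  vanishes_outside K f -> (lebesgue_rv R n).-integrable setT (EFin \o f).
Proof.
move=> cf f0; pose B := @cbox R n (fun=> - K) (fun=> K).
have mB : measurable B by exact: measurable_cbox.
have -> : EFin \o f = (EFin \o f) \_ B.
  apply/funext => x; rewrite patchE; case: ifPn => //.
  rewrite notin_setE /= => /existsNP[j /negP].
  rewrite in_itv/= -ler_norml -ltNge => /ltW Kt.
  by rewrite f0//; exists j.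
refine ((integrable_mkcond _ mB).1 _).
refine (@measurable_bounded_integrable _ _ _ (lebesgue_rv R n) f B _ _ _ _) => //.
- exact: cbox_lty.
- apply: measurable_funS (measurable_continuous _ _ openT _) => //.
  by move=> x _; exact: cf.
- exact: continuous_bounded_cbox.
Qed.

(** Induction on the dimension along x = (x0, y). For the direction of x0,
    integrate in x0 first: each inner integral is 0 by the fundamental theorem of
    calculus. For any other direction, integrate in y first: each slice is an
    instance of the induction hypothesis. *)
Theorem integral_partial_eq0 {n} (i : 'I_n) (w w' : 'rV[R]_n -> R) (K : R) : 0 < K ->
  continuous w' -> (forall x, is_derive x (delta_mx ord0 i) w (w' x)) ->
  vanishes_outside K w -> vanishes_outside K w' ->
  (\int[lebesgue_rv R n]_x (w' x)%:E = 0)%E.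
Proof.
elim: n i w w' => [[]//|n IH] i w w' K0 cw' dw w0 w'0.
have iw' := integrable_vanishes _ _ cw' w'0.
have mcons := @measurable_rv_cons R n.
have mw' : measurable_fun setT (EFin \o w').
  apply/measurable_EFinP; apply: measurable_continuous => [|x _]; first exact: openT.
  exact: cw'.
pose m2 := (@lebesgue_measure R \x lebesgue_rv R n)%E.
have iw'c : m2.-integrable setT ((EFin \o w') \o @rv_cons R n).
  have /integrableP[_ iw] := iw'.
  apply/integrableP; split; first exact: measurableT_comp.
  have mabs : measurable_fun setT (abse \o (EFin \o w')) by exact: measurableT_comp.
  have E := @ge0_integral_pushforward _ _ _ _ _ _ mcons m2 setT _ measurableT mabs _.
  apply: le_lt_trans iw; rewrite le_eqVlt; apply/orP; left; apply/eqP/esym.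
  by apply: E => y _; exact: abse_ge0.
transitivity (\int[m2]_z ((EFin \o w') \o @rv_cons R n) z)%E.
  exact: (integral_pushforward mcons mw' iw'c measurableT).
case: (unliftP ord0 i) dw => [j|] -> dw.
  rewrite -integral12_prod_meas1//.
  apply: integral0_eq => x0 _; rewrite /fubini_F.
  apply: (IH j (fun y => w (rv_cons (x0, y))) (fun y => w' (rv_cons (x0, y)))) => //.
  - by move=> y; apply: continuous_comp; [exact: continuous_rv_cons_r|exact: cw'].
  - move=> y; apply: is_derive_of_quotient (dw (rv_cons (x0, y))) => h.
    by rewrite rv_cons_lineS.
  - by move=> y [k yk]; apply: w0; exists (lift ord0 k); rewrite rv_cons_lift.
  - by move=> y [k yk]; apply: w'0; exists (lift ord0 k); rewrite rv_cons_lift.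
rewrite -integral21_prod_meas1//.
apply: integral0_eq => y _; rewrite /fubini_G.
apply: (@integral_derive_eq0 (fun x0 => w (rv_cons (x0, y)))
  (fun x0 => w' (rv_cons (x0, y))) K) => //.
- by move=> x0; apply: continuous_comp; [exact: continuous_rv_cons_l|exact: cw'].
- move=> x0; apply: is_derive_of_quotient (dw (rv_cons (x0, y))) => h.
  by rewrite rv_cons_line0 [_%:A]mulr1.
- by move=> t tK; apply: w0; exists ord0; rewrite rv_cons_ord0.
- by move=> t tK; apply: w'0; exists ord0; rewrite rv_cons_ord0.
Qed.

End IntegralDerivative.

(** * Test functions of product form *)
Section Tensor.
Context {R : realType} {n : nat}.
Local Notation V := 'rV[R]_n.
Implicit Types (psi : 'I_n -> R -> R).

(** A class of functions on R^n that is closed under all partial derivatives,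
    because differentiating in direction i acts on the i-th factor alone. *)
Definition tensor psi : V -> R := fun x => \prod_(i < n) psi i (x ord0 i).

Definition tensor_deriv psi (i : 'I_n) : 'I_n -> R -> R :=
  fun j => if j == i then derive1 (psi j) else psi j.

Lemma tensor_is_derive psi (i : 'I_n) x : (forall j, smooth1 (psi j)) ->
  is_derive x (delta_mx ord0 i) (tensor psi) (tensor (tensor_deriv psi i) x).
Proof.
move=> spsi; pose c := \prod_(j < n | j != i) psi j (x ord0 j).
apply: (@is_derive_of_quotient _ _ _ (fun t : R => c * psi i t) _ (x ord0 i) (1 : R)).
  move=> h; rewrite /tensor (bigD1 i)//= mulrC !mxE !eqxx /=; congr (psi i _ * _).
  apply: eq_bigr => j ji; by rewrite !mxE eqxx (negbTE ji) mulr0 add0r.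
have di := smooth1_is_derive (psi i) (x ord0 i) (spsi i).
have -> : tensor (tensor_deriv psi i) x = c *: derive1 (psi i) (x ord0 i).
  rewrite /tensor (bigD1 i)//= /tensor_deriv eqxx mulrC; congr (_ * _).
  by apply: eq_bigr => j /negbTE ->.
exact: (@is_deriveZ _ _ _ (psi i) c).
Qed.

Lemma smooth1_tensor_deriv psi i : (forall j, smooth1 (psi j)) ->
  forall j, smooth1 (tensor_deriv psi i j).
Proof. by move=> s j; rewrite /tensor_deriv; case: ifP => _ //; exact: smooth1_deriv. Qed.

Lemma partial_tensor psi i : (forall j, smooth1 (psi j)) ->
  partial i (tensor psi) = tensor (tensor_deriv psi i).
Proof.
by move=> s; apply/funext => x; case: (tensor_is_derive psi i x s).
Qed.

Lemma continuous_tensor psi : (forall j, smooth1 (psi j)) -> continuous (tensor psi).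
Proof.
move=> spsi.
have := @continuous_big R _ *%R 1 xpredT (@mul_continuous R) V
  (index_enum 'I_n) (fun i (x : V) => psi i (x ord0 i)).
apply.
move=> i _ x; apply: (@continuous_comp _ _ _ (fun x : V => x ord0 i) (psi i)).
  exact: coord_continuous.
exact: (spsi i 0).
Qed.

Lemma smooth_tensor psi : (forall j, smooth1 (psi j)) -> smooth (tensor psi).
Proof.
move=> spsi s.
have [psi' [spsi' ->]] : exists psi', (forall j, smooth1 (psi' j)) /\
    foldr (@partial R n) (tensor psi) s = tensor psi'.
  elim: s => [|i s [psi' [spsi' IH]]]; first by exists psi.
  exists (tensor_deriv psi' i); split; first exact: smooth1_tensor_deriv.
  by rewrite /= IH partial_tensor.
split; last by move=> i x; case: (tensor_is_derive psi' i x spsi').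
exact: continuous_tensor.
Qed.

Lemma closed_cbox (a b : 'I_n -> R) : closed (cbox a b).
Proof. by apply: compact_closed; [exact: norm_hausdorff|exact: compact_cbox]. Qed.

Definition bump_box (k : R) (a b : 'I_n -> R) : V -> R :=
  tensor (fun i => bump_itv k (a i) (b i)).

Lemma bump_box_out k a b x : 0 < k -> ~ obox a b x -> bump_box k a b x = 0.
Proof.
move=> k0 /existsNP[i /negP xi].
by rewrite /bump_box /tensor (bigD1 i)//= bump_itv_out// mul0r.
Qed.

Lemma bump_box_ge0 k a b x : 0 <= bump_box k a b x.
Proof. by apply: prodr_ge0 => i _; exact: bump_itv_ge0. Qed.

Lemma bump_box_le1 k a b x : bump_box k a b x <= 1.
Proof. by apply: prodr_ile1 => i _; rewrite bump_itv_ge0 bump_itv_le1. Qed.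

Lemma smooth_bump_box k a b : smooth (bump_box k a b).
Proof. by apply: smooth_tensor => i; exact: smooth1_bump_itv. Qed.

Definition supp (phi : V -> R) : set V := closure [set x : V | phi x != 0].

Lemma supp_bump_box k a b : 0 < k -> supp (bump_box k a b) `<=` cbox a b.
Proof.
move=> k0; rewrite [X in _ `<=` X](closure_id _).1; last exact: closed_cbox.
apply: closure_subset => x /= h; apply: obox_cbox; apply: contrapT => nx.
by move: h; rewrite bump_box_out ?eqxx.
Qed.

Lemma test_function_supp (phi : V -> R) a b O : smooth phi ->
  supp phi `<=` cbox a b -> cbox a b `<=` O -> test_function O phi.
Proof.
move=> sphi sub abO; split => //; last exact: subset_trans sub abO.
by apply: subclosed_compact sub; [exact: closed_closure|exact: compact_cbox].
Qed.

Lemma test_function_bump_box k a b O : 0 < k -> cbox a b `<=` O ->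
  test_function O (bump_box k a b).
Proof.
move=> k0; apply: test_function_supp; first exact: smooth_bump_box.
exact: supp_bump_box.
Qed.

Lemma bump_box_cvg a b x :
  bump_box k.+1%:R a b x @[k --> \oo] --> (\1_(obox a b) x : R).
Proof.
have -> : \1_(obox a b) x = \prod_(i < n) (if x ord0 i \in `]a i, b i[ then 1 else 0 : R).
  rewrite indicE; case: (boolP (x \in obox a b)).
    rewrite inE => xab; rewrite big1// => i _; by rewrite (xab i).
  rewrite notin_setE => /existsNP[i /negP/negbTE xi].
  by rewrite (bigD1 i)//= xi mul0r.
apply: (@cvg_big R _ *%R 1 xpredT (@mul_continuous R)).
by move=> i _; exact: bump_itv_cvg.
Qed.

End Tensor.

(** * The fundamental lemma of the calculus of variations *)
Section FundamentalLemma.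
Context {R : realType} {n : nat}.
Local Notation V := 'rV[R]_n.
Local Notation mu := (lebesgue_rv R n).
Local Open Scope ereal_scope.

(** The indicator of the open box is the limit of the test functions
    [bump_box k a b], all bounded by 1: dominated convergence with bound |g|. *)
Lemma integral_obox_eq0 (O : set V) (g : V -> R) (a b : 'I_n -> R) :
  measurable O -> mu.-integrable O (EFin \o g) ->
  (forall phi, test_function O phi -> \int[mu]_(x in O) (g x * phi x)%:E = 0) ->
  cbox a b `<=` O -> \int[mu]_(x in obox a b) (g x)%:E = 0.
Proof.
move=> mO ig g0 abO.
have -> : obox a b = O `&` obox a b.
  by apply/esym/setIidPr; exact: subset_trans (@obox_cbox _ _ a b) abO.
rewrite integral_mkcondr.
have mg : measurable_fun O g by apply/measurable_EFinP; case/integrableP : ig.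
pose f_ k := fun x => (g x * bump_box k.+1%:R a b x)%:E.
pose f := (fun x => (g x)%:E) \_ (obox a b).
have mf_ k : measurable_fun O (f_ k).
  apply/measurable_EFinP; apply: measurable_funM => //.
  apply: measurable_funS (measurable_continuous setT _ openT _) => // x _.
  exact: (smooth_bump_box _ _ _ [::]).1.
have fE x : f x = (g x * \1_(obox a b) x)%:E.
  by rewrite /f patchE indicE; case: ifP; rewrite ?mulr1 ?mulr0.
have f_f x : f_ k x @[k --> \oo] --> f x.
  rewrite fE; apply: cvg_EFin; first exact: nearW.
  by apply: cvgMl_tmp; exact: bump_box_cvg.
have mf : measurable_fun O f.
  by apply: (emeasurable_fun_cvg _ _ mf_) => x _; exact: f_f.
have [] := @dominated_convergence _ _ _ mu O mO f_ f (fun x => `|(g x)%:E|) mf_ mf.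
- exact: aeW.
- exact: integrable_abse.
- apply: aeW => x k Ox; rewrite /f_ lee_fin normrM -[leRHS]mulr1 ler_wpM2l//.
  by rewrite ger0_norm ?bump_box_ge0 ?bump_box_le1.
move=> _ _; rewrite (_ : [sequence _]_k = cst 0); last first.
  by apply/funext => k; apply: g0; exact: test_function_bump_box.
by move/cvg_lim => <-//; rewrite lim_cst.
Qed.

(** The measurable sets A such that g has zero integral over the part of A in the
    given box form a Dynkin system; it contains the pi-system of open boxes, as
    two boxes intersect in a box. *)
Lemma ae_eq0_obox (O : set V) (g : V -> R) (a b : 'I_n -> R) :
  measurable O -> mu.-integrable O (EFin \o g) ->
  (forall phi, test_function O phi -> \int[mu]_(x in O) (g x * phi x)%:E = 0) ->
  cbox a b `<=` O -> {ae mu, forall x, obox a b x -> g x = 0%R}.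
Proof.
move=> mO ig g0 abO; set Q := obox a b.
have mQ : measurable Q by exact: measurable_obox.
have igQ : mu.-integrable Q (EFin \o g).
  by apply: integrableS ig => //; exact: subset_trans (@obox_cbox _ _ a b) abO.
have QP : forall A, measurable A -> \int[mu]_(x in A `&` Q) (g x)%:E = 0.
  move=> A; rewrite measurable_rV_oboxes; move: A.
  refine (@dynkin_induction _ _ _
    (fun A => \int[mu]_(x in A `&` Q) (g x)%:E = 0) _ _ _ _ _ _).
  - exact: measurable_rV_oboxes.
  - exact: setI_closed_oboxes.
  - by rewrite setTI; exact: integral_obox_eq0 g0 abO.
  - move=> _ [a' [b' ->]]; rewrite oboxI; apply: (integral_obox_eq0 _ _ _ _ mO ig g0).
    apply: subset_trans abO => x h i; have := h i; rewrite !in_itv/= ge_max le_min.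
    by move=> /andP[/andP[_ ->] /andP[_ ->]].
  - move=> A mA A0.
    have : \int[mu]_(x in (A `&` Q) `|` (~` A `&` Q)) (g x)%:E = 0.
      rewrite -setIUl setUv setTI; exact: integral_obox_eq0 g0 abO.
    rewrite integral_setU//=.
    + by rewrite A0 add0e.
    + exact: measurableI.
    + by apply: measurableI => //; exact: measurableC.
    + by rewrite -setIUl setUv setTI; case/integrableP : igQ.
    + by apply/disj_setPS; rewrite setIACA setICr set0I.
  - move=> F mF tF F0; rewrite setI_bigcupl integral_bigcup.
    + by apply: eseries0 => k _ _; exact: F0.
    + exact: trivIset_setIr.
    + by move=> k; exact: measurableI.
    + apply: (integrableS mQ) igQ; last by move=> x [k _ []].
      by apply: bigcupT_measurable => k; exact: measurableI.
have := @integral_ae_eq _ _ _ mu Q mQ (cst 0) (EFin \o g) igQ (measurable_cst _).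
move=> /(_ _)[|Z [mZ Z0 h]].
  move=> E EQ mE; rewrite integral0; have := QP E mE.
  by rewrite ((setIidPl _ _).2 EQ).
exists Z; split=> // x /= nx; apply: h => /= h; apply: nx => Qx.
by have [] := h Qx.
Qed.

Theorem fundamental_lemma_variations (O : set V) (g : V -> R) :
  open O -> mu.-integrable O (EFin \o g) ->
  (forall phi, test_function O phi -> \int[mu]_(x in O) (g x * phi x)%:E = 0) ->
  {ae mu, forall x, O x -> g x = 0%R}.
Proof.
move=> oO ig g0; have mO := measurable_open _ oO.
have [B [hB OB]] := open_bigcup_obox _ oO.
have : {ae mu, forall x, forall k, B k x -> g x = 0%R}.
  apply: ae_foralln => k; have [->|[a [b [-> abO]]]] := hB k; first exact: aeW.
  exact: ae_eq0_obox g0 abO.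
by apply: filterS => x h; rewrite OB => -[k _]; exact: h.
Qed.

End FundamentalLemma.

(** * Estimates in L^p *)
Section LpOnOpen.
Context {R : realType} {n : nat}.
Local Notation V := 'rV[R]_n.
Local Notation mu := (lebesgue_rv R n).
Implicit Types (O A : set V) (p B : R) (f g u : V -> R).

Lemma Lp_normE O p f : p != 0 ->
  Lp_norm O p%:E f = ((\int[mu]_(x in O) (`|f x| `^ p)%:E) `^ p^-1)%E.
Proof.
move=> p0; rewrite /Lp_norm unlock /=; congr (_ `^ _)%E; rewrite [RHS]integral_mkcond.
apply: eq_integral => x _; rewrite !patchE; case: ifP => _ /=; first by [].
by rewrite normr0 powR0.
Qed.

Lemma Lp_norm_ge0 O p f : (0 <= Lp_norm O p%:E f)%E.
Proof. by rewrite /Lp_norm Lnorm_ge0. Qed.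

Lemma eq_Lp_norm O p f g : p != 0 -> {ae mu, forall x, O x -> f x = g x} ->
  Lp_norm O p%:E f = Lp_norm O p%:E g.
Proof.
move=> p0 fg; rewrite (Lp_normE O p f p0) (Lp_normE O p g p0); congr (_ `^ _)%E; apply: ae_eq_integral_nonmeas.
by apply: filterS fg => x h Ox; rewrite h.
Qed.

(** With a set [A] that carries the function, the estimate sees the volume of the
    support of a spike; with [A] empty it covers functions vanishing almost
    everywhere, and with [A = O] merely bounded ones. *)
Lemma Lp_norm_le O p f B A : 0 < p -> measurable A ->
  {ae mu, forall x, O x -> `|f x| <= B * \1_A x} ->
  (Lp_norm O p%:E f <= ((B `^ p)%:E * mu A) `^ p^-1)%E.
Proof.
move=> p0 mA fB; rewrite Lp_normE ?gt_eqF//.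
have pV0 : 0 <= p^-1 by rewrite invr_ge0 ltW.
apply: gt0_ler_poweR => //.
- by rewrite in_itv/= leey andbT; apply: integral_ge0 => x _; rewrite lee_fin powR_ge0.
- by rewrite in_itv/= leey andbT mule_ge0// lee_fin powR_ge0.
rewrite -integral_cst//= [leRHS]integral_mkcond [leLHS]integral_mkcond.
apply: ae_le_integral_nonmeas; apply: filterS fB => x fB _.
rewrite !patchE; case: ifPn => [|_]; last by case: ifP => //; rewrite lee_fin powR_ge0.
rewrite inE => /fB; rewrite indicE; case: (x \in A); rewrite ?mulr1 ?mulr0 lee_fin.
  move=> fxB; apply: ge0_ler_powR => //; first exact: ltW.
  by rewrite nnegrE; exact: le_trans fxB.
by rewrite normr_le0 => /eqP ->; rewrite normr0 powR0 ?gt_eqF.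
Qed.

Lemma Lp_norm_eq0 O p f : 0 < p -> {ae mu, forall x, O x -> f x = 0} ->
  Lp_norm O p%:E f = 0%E.
Proof.
move=> p0 f0; apply/eqP; rewrite eq_le Lp_norm_ge0 andbT.
have := @Lp_norm_le O p f 0 set0 p0 measurable0 _.
rewrite measure0 mule0 poweR0r ?invr_eq0 ?gt_eqF//; apply.
by apply: filterS f0 => x f0 Ox; rewrite f0// normr0 mul0r.
Qed.

Lemma bounded_lty O : measurable O -> bounded_set O -> (mu O < +oo)%E.
Proof.
move=> mO /bounded_cbox[K _ OK]; apply: le_lt_trans (cbox_lty (fun=> - K) (fun=> K)).
by apply: le_measure; rewrite ?inE//; exact: measurable_cbox.
Qed.

(** On a set of finite measure L^p is contained in L^1, because
    |f| <= 1 + |f|^p. *)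
Lemma Lp_integrable O p f : measurable O -> (mu O < +oo)%E -> 1 <= p ->
  Lp O p%:E f -> mu.-integrable O (EFin \o f).
Proof.
move=> mO Oy p1 [mf]; have p0 : 0 < p by exact: lt_le_trans p1.
rewrite Lp_normE ?gt_eqF// => /lty_poweRy; rewrite invr_eq0 gt_eqF// => /(_ isT) fy.
have mfp : measurable_fun O (fun x => `|f x| `^ p).
  apply: (@measurableT_comp _ _ _ _ _ _ (@powR R ^~ p)).
    exact: measurable_powR.
  exact: measurableT_comp.
have ifp : mu.-integrable O (fun x => (`|f x| `^ p)%:E).
  apply/integrableP; split; first exact/measurable_EFinP.
  by under eq_integral do rewrite gee0_abs ?lee_fin ?powR_ge0//.
have i1 : mu.-integrable O (cst 1%E).
    apply/integrableP; split; first exact: measurable_cst.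
    by under eq_integral do rewrite /= normr1; rewrite (integral_cst _ mO)// mul1e.
apply: (le_integrable mO _ _ (integrableD mO i1 ifp)).
  exact/measurable_EFinP.
move=> x Ox /=; rewrite lee_fin [leRHS]ger0_norm ?addr_ge0 ?powR_ge0//.
have [f1|f1] := leP `|f x| 1; first by rewrite ler_wpDr ?powR_ge0.
by rewrite ler_wpDl// le1r_powR// ltW.
Qed.

Lemma Lp_bounded O p f B : measurable O -> (mu O < +oo)%E -> 0 < p ->
  measurable_fun O f -> (forall x, O x -> `|f x| <= B) -> Lp O p%:E f.
Proof.
move=> mO Oy p0 mf fB; split => //.
apply: le_lt_trans (@Lp_norm_le O p f B O p0 mO _) _.
  by apply: aeW => x Ox; rewrite indicE mem_set// mulr1; exact: fB.
by apply: poweR_lty; rewrite lte_mul_pinfty// lee_fin powR_ge0.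
Qed.

End LpOnOpen.

(** * Weak and classical gradients *)
Section WeakGradient.
Context {R : realType} {n : nat}.
Local Notation V := 'rV[R]_n.
Local Notation mu := (lebesgue_rv R n).
Implicit Types (O A S : set V) (p B : R) (f u phi : V -> R) (g : V -> V).

(** The form common to smooth functions on the whole space and to functions of
    class C^1 on the closure of [O], whose values off [O] are arbitrary. *)
Definition C1_on O u := forall x, O x -> {for x, continuous u} /\
  forall i, derivable u x (delta_mx ord0 i) /\ {for x, continuous (partial i u)}.

Lemma smooth_C1_on u : smooth u -> forall O, C1_on O u.
Proof.
move=> su O x _; split; first exact: (su [::]).1.
by move=> i; split; [exact: (su [::]).2|exact: (su [:: i]).1].
Qed.

Lemma near_out_supp phi x : ~ supp phi x -> \forall y \near x, ~ supp phi y.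
Proof.
move=> Sx; apply: (@open_nbhs_nbhs _ x (~` supp phi)); split => //.
by rewrite openC; exact: closed_closure.
Qed.

(** At a point of the support of [phi] both factors are continuous; near any
    other point [psi] is 0. *)
Lemma continuous_cutoff O u psi phi : (forall x, O x -> {for x, continuous u}) ->
  continuous psi -> supp phi `<=` O -> (forall x, ~ supp phi x -> psi x = 0) ->
  continuous (fun x => u x * psi x).
Proof.
move=> cu cpsi SO psi0 x; case: (pselect (supp phi x)) => Sx.
  exact: (cvgM (cu _ (SO _ Sx)) (cpsi x)).
have nS := near_out_supp _ _ Sx.
move/(_ x): (psi0) => psi0x; rewrite /continuous_at psi0x// mulr0.
apply: (@cvg_near_cst V R 0 _ (nbhs x)).
by apply: filterS nS => y /psi0 ->; rewrite mulr0.
Qed.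

Lemma partial_out_supp phi i x : ~ supp phi x -> partial i phi x = 0.
Proof.
move=> Sx; transitivity ('D_(delta_mx ord0 i) (cst (0 : R) : V -> R) x).
  2: exact: derive_cst.
apply: near_eq_derive.
have := near_out_supp _ _ Sx.
apply: filterS => y nS; apply: contrapT => phiy; apply: nS.
by apply: subset_closure => /=; apply/eqP.
Qed.

Lemma out_supp phi x : ~ supp phi x -> phi x = 0.
Proof.
by move=> nS; apply: contrapT => phiy; apply: nS; apply: subset_closure => /=; apply/eqP.
Qed.

Lemma Rintegral_supported O (h : V -> R) : (forall x, ~ O x -> h x = 0) ->
  \int[mu]_(x in O) h x = \int[mu]_x h x.
Proof.
move=> h0; rewrite /Rintegral integral_mkcond; congr fine.
apply: eq_integral => x _; rewrite patchE; case: ifPn => //.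
by rewrite notin_setE => /h0 ->.
Qed.

(** The product u phi, extended by 0, has a continuous compactly supported
    derivative in direction i, whose integral vanishes. *)
Lemma integration_by_parts O u phi i : C1_on O u -> test_function O phi ->
  \int[mu]_(x in O) (u x * partial i phi x) =
  - \int[mu]_(x in O) (partial i u x * phi x).
Proof.
move=> Cu [sphi cS SO]; pose S := supp phi.
have cu : forall x, O x -> {for x, continuous u} by move=> x /Cu[].
have cdu : forall x, O x -> {for x, continuous (partial i u)}.
  by move=> x /Cu[_ /(_ i)[]].
have cphi : continuous phi by exact: (sphi [::]).1.
have cdphi : continuous (partial i phi) by exact: (sphi [:: i]).1.
have c1 : continuous (fun x => u x * partial i phi x).
  by apply: (continuous_cutoff O _ _ phi) => // x; exact: partial_out_supp.
have c2 : continuous (fun x => partial i u x * phi x).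
  by apply: (continuous_cutoff O _ _ phi) => // x; exact: out_supp.
have [K K0 SK] := bounded_cbox _ (compact_bounded cS).
(* [K + 1] and not [K]: the support may touch the boundary of the cube of half
   width [K], where [vanishes_outside K] already requires the value 0. *)
have outK (x : V) : (exists j, K + 1 <= `|x ord0 j|) -> ~ S x.
  move=> [j jK] /SK/(_ j); rewrite in_itv/= -ler_norml => /le_lt_trans.
  by move/(_ (K + 1)); rewrite ltrDl ltr01 => /(_ isT); rewrite ltNge jK.
have v1 : vanishes_outside (K + 1) (fun x => u x * partial i phi x).
  by move=> x /outK nS; rewrite partial_out_supp// mulr0.
have v2 : vanishes_outside (K + 1) (fun x => partial i u x * phi x).
  by move=> x /outK nS; rewrite (out_supp phi)// mulr0.
have nO x : ~ O x -> ~ S x by move=> nOx /SO.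
rewrite (Rintegral_supported O (fun x => u x * partial i phi x)); last first.
  by move=> x /nO nS; rewrite partial_out_supp// mulr0.
rewrite (Rintegral_supported O (fun x => partial i u x * phi x)); last first.
  by move=> x /nO nS; rewrite (out_supp phi)// mulr0.
have i1 := integrable_vanishes _ _ c1 v1.
have i2 := integrable_vanishes _ _ c2 v2.
apply/eqP; rewrite -addr_eq0 -RintegralD//; apply/eqP.
suff E : (\int[mu]_x (u x * partial i phi x + partial i u x * phi x)%:E = 0)%E.
  by rewrite /Rintegral E.
apply: (@integral_partial_eq0 R n i (fun x => u x * phi x)
  (fun x => u x * partial i phi x + partial i u x * phi x) (K + 1)).
- by rewrite addr_gt0.
- by move=> x; exact: (cvgD (c1 x) (c2 x)).
- move=> x; case: (pselect (S x)) => Sx.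
    have [_ /(_ i)[dux _]] := Cu _ (SO _ Sx).
    have du := derivableP dux.
    have dphi := derivableP ((sphi [::]).2 i x).
    apply: (is_derive_eq (is_deriveM du dphi)).
    by rewrite /GRing.scale/= [phi x * _]mulrC.
  rewrite (out_supp phi)// partial_out_supp// !mulr0 addr0.
  apply: (near_eq_is_derive _ (is_derive_cst (0 : R) x (delta_mx ord0 i))).
  have := near_out_supp _ _ Sx.
  by apply: filterS => y nS; rewrite (out_supp phi)// mulr0.
- by move=> x /outK nS; rewrite (out_supp phi)// mulr0.
- by move=> x vx; rewrite v1// v2// addr0.
Qed.

Lemma weak_gradient_gradient O p u : C1_on O u ->
  (forall i, Lp O p%:E (partial i u)) -> weak_gradient O p%:E u (gradient u).
Proof.
move=> Cu Lu; have gE i : (fun x => gradient u x ord0 i) = partial i u.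
  by apply/funext => x; rewrite mxE.
split=> [i|phi i tphi]; first by rewrite gE.
rewrite (integration_by_parts _ _ _ _ Cu tphi); congr (- _).
by apply: eq_Rintegral => x _; rewrite mxE.
Qed.

Lemma continuous_bounded_on O phi : continuous phi ->
  bounded_set O -> [bounded phi x | x in O].
Proof.
move=> cphi /bounded_cbox[K _ OK].
have := @continuous_bounded_cbox R n phi (fun=> - K) (fun=> K) cphi.
by rewrite /bounded_near; apply: filterS => M h x /OK; exact: h.
Qed.

(** Two weak gradients have the same integrals against every test function, and
    they are integrable since [O] is bounded. *)
Lemma weak_gradient_unique O p u g g' : open O -> bounded_set O -> 1 <= p ->
  weak_gradient O p%:E u g -> weak_gradient O p%:E u g' ->
  {ae mu, forall x, O x -> g x = g' x}.
Proof.
move=> oO bO p1 [Lg gE] [Lg' g'E].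
have mO := measurable_open _ oO; have Oy := bounded_lty _ mO bO.
have ig i := Lp_integrable _ _ _ mO Oy p1 (Lg i).
have ig' i := Lp_integrable _ _ _ mO Oy p1 (Lg' i).
have h i : {ae mu, forall x, O x -> g x ord0 i - g' x ord0 i = 0}.
  apply: fundamental_lemma_variations => //.
    exact: (integrableB mO (ig i) (ig' i)).
  move=> phi tphi; have cphi : continuous phi by case: tphi => /(_ [::])[].
  have mphi : measurable_fun O phi.
    by apply: measurable_continuous => // x _; exact: cphi.
  have bphi := continuous_bounded_on _ _ cphi bO.
  have i1 : mu.-integrable O (EFin \o (fun x => g x ord0 i * phi x)).
    exact: (integrableMl mO (ig i) mphi bphi).
  have i2 : mu.-integrable O (EFin \o (fun x => g' x ord0 i * phi x)).
    exact: (integrableMl mO (ig' i) mphi bphi).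
  have E := RintegralB mO i1 i2.
  have : \int[mu]_(x in O) (g x ord0 i * phi x) = \int[mu]_(x in O) (g' x ord0 i * phi x).
    by apply: oppr_inj; rewrite -gE// -g'E.
  move/eqP; rewrite -subr_eq0 -E => /eqP {}E.
  under eq_integral do rewrite mulrBl.
  rewrite -(fineK (integrable_fin_num mO (integrableB mO i1 i2))).
  by congr EFin.
have : {ae mu, forall x, forall i, O x -> g x ord0 i - g' x ord0 i = 0}.
  exact: filter_forall.
by apply: filterS => x gx Ox; apply/rowP => i; apply/eqP; rewrite -subr_eq0 gx.
Qed.

Lemma wgrad_gradient O p u : open O -> bounded_set O -> 1 <= p -> C1_on O u ->
  (forall i, Lp O p%:E (partial i u)) ->
  {ae mu, forall x, O x -> wgrad O p%:E u x = gradient u x}.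
Proof.
move=> oO bO p1 Cu Lu; have wg := weak_gradient_gradient _ _ _ Cu Lu.
apply: weak_gradient_unique (wg) => //.
have := @xgetPex _ (fun=> 0) [set g : V -> V | weak_gradient O p%:E u g].
by apply; exists (gradient u).
Qed.

(** This makes the norm computable, which is defined from an arbitrarily chosen
    weak gradient. *)
Lemma W_norm_gradient O p u : open O -> bounded_set O -> 1 <= p -> C1_on O u ->
  (forall i, Lp O p%:E (partial i u)) ->
  W_norm O p%:E u = Lp_norm O p%:E (fun x => euclid_norm (gradient u x)).
Proof.
move=> oO bO p1 Cu Lu; apply: eq_Lp_norm; first by rewrite gt_eqF// (lt_le_trans _ p1).
by apply: filterS (wgrad_gradient _ _ _ oO bO p1 Cu Lu) => x h Ox; rewrite h.
Qed.

Lemma Lp_continuous O p u : open O -> bounded_set O -> 0 < p -> continuous u ->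
  Lp O p%:E u.
Proof.
move=> oO bO p0 cu; have mO := measurable_open _ oO.
have [M [_ hM]] := continuous_bounded_on _ _ cu bO.
have M1 : M < M + 1 by rewrite ltrDl.
apply: (Lp_bounded _ _ _ (M + 1)) => //; first exact: bounded_lty.
  by apply: measurable_continuous => // x _; exact: cu.
by move=> x Ox; exact: (hM _ M1).
Qed.

Lemma Lp_partial_smooth O p u : open O -> bounded_set O -> 0 < p -> smooth u ->
  forall i, Lp O p%:E (partial i u).
Proof. by move=> oO bO p0 su i; apply: Lp_continuous => //; exact: (su [:: i]).1. Qed.

(** The constant sequence approximates; its gradients converge because the chosen
    weak gradient is the classical one almost everywhere. *)
Lemma test_function_W01p O p u : open O -> bounded_set O -> 1 <= p ->
  test_function O u -> W01p O p%:E u.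
Proof.
move=> oO bO p1 tu; have su : smooth u by case: tu.
have p0 : 0 < p by exact: lt_le_trans p1.
have Cu := smooth_C1_on _ su O; have Lu := Lp_partial_smooth _ _ _ oO bO p0 su.
split.
  split; first by apply: Lp_continuous => //; exact: (su [::]).1.
  by exists (gradient u); exact: weak_gradient_gradient.
exists (fun=> u); split=> // [|i].
  rewrite Lp_norm_eq0//; first exact: cvg_cst.
  by apply: aeW => x _; rewrite subrr.
rewrite Lp_norm_eq0//; first exact: cvg_cst.
apply: filterS (wgrad_gradient _ _ _ oO bO p1 Cu Lu) => x h Ox.
by rewrite h// mxE subrr.
Qed.

Lemma partial0 i : partial i (fun=> 0 : R) = (fun=> 0) :> (V -> R).
Proof. by apply/funext => x; exact: derive_cst. Qed.

Lemma euclid_norm_ge_coord (v : V) i : `|v ord0 i| <= euclid_norm v.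
Proof.
rewrite /euclid_norm -sqrtr_sqr ler_wsqrtr// (bigD1 i)//= lerDl.
by apply: sumr_ge0 => j _; rewrite sqr_ge0.
Qed.

Lemma euclid_norm_le (v : V) B : (forall i, `|v ord0 i| <= B) -> euclid_norm v <= n%:R * B.
Proof.
case: (posnP n) => [n0 _|n0 vB].
  rewrite /euclid_norm big1 ?sqrtr0 => [|i _]; last by have := ltn_ord i; rewrite {2}n0.
  by rewrite (_ : n%:R = 0 :> R) ?mul0r// n0.
have B0 : 0 <= B by exact: le_trans (vB (Ordinal n0)).
rewrite -[leRHS]ger0_norm ?mulr_ge0// -sqrtr_sqr ler_wsqrtr//.
apply: (@le_trans _ _ (\sum_(i < n) B ^+ 2)).
  by apply: ler_sum => i _; rewrite -real_normK ?num_real// lerXn2r ?nnegrE.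
rewrite sumr_const card_ord exprMn -[leLHS]mulr_natl ler_wpM2r ?sqr_ge0//.
by rewrite -natrX ler_nat -mulnn leq_pmulr.
Qed.

Lemma smooth0 : smooth (fun _ : V => 0 : R).
Proof.
move=> s; have -> : foldr (@partial R n) (fun=> 0) s = (fun=> 0).
  by elim: s => //= i s ->; exact: partial0.
by split; [exact: cst_continuous|move=> i x; exact: derivable_cst].
Qed.

Lemma W_norm0 O p : open O -> bounded_set O -> 1 <= p -> W_norm O p%:E (fun=> 0) = 0%E.
Proof.
move=> oO bO p1; have p0 : 0 < p by exact: lt_le_trans p1.
rewrite W_norm_gradient//; last 2 first.
- exact: smooth_C1_on smooth0 O.
- exact: Lp_partial_smooth _ _ _ oO bO p0 smooth0.
apply: Lp_norm_eq0 => //; apply: aeW => x _.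
by rewrite /euclid_norm big1 ?sqrtr0// => i _; rewrite mxE partial0 expr0n.
Qed.

End WeakGradient.

(** * Concentrating spikes *)
Section FlatBounds.
Context {R : realType}.

Lemma flat0_ge (t : R) : 2^-1 <= t -> expR (- 2) <= flat 0 t.
Proof.
move=> t2; have t0 : 0 < t by apply: lt_le_trans t2; rewrite invr_gt0.
rewrite /flat t0 expr0 mul1r ler_expR lerN2 -[leRHS]invrK lef_pV2//.
by rewrite posrE invr_gt0.
Qed.

(** Both terms of the derivative are k times a product of [flat 0 <= 1] and
    [flat 2 <= 2]. *)
Lemma bump_itv_deriv_le (k a b t : R) : 0 <= k -> `|derive1 (bump_itv k a b) t| <= 4 * k.
Proof.
move=> k0.
have d0 : is_derive t 1 (fun t : R => flat 0 (k * (t - a))) (flat 2 (k * (t - a)) * k).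
  apply: (@is_derive1_comp _ (flat 0) (fun t => k * (t - a))).
    by apply: is_derive_eq (flat_is_derive _ _) _; rewrite mul0r subr0.
  by apply: is_derive_eq; rewrite /GRing.scale /= subr0 mulr1.
have d1 : is_derive t 1 (fun t : R => flat 0 (k * (b - t))) (flat 2 (k * (b - t)) * (- k)).
  apply: (@is_derive1_comp _ (flat 0) (fun t => k * (b - t))).
    by apply: is_derive_eq (flat_is_derive _ _) _; rewrite mul0r subr0.
  by apply: is_derive_eq; rewrite /GRing.scale /= add0r mul1r mulrN mulr1.
have := is_deriveM d0 d1.
rewrite derive1E => -[_ ->]; rewrite /GRing.scale/=.
have := flat_bound 2 (k * (t - a)); have := flat_bound 2 (k * (b - t)).
have := flat_ge0 2 (k * (t - a)); have := flat_ge0 2 (k * (b - t)).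
have := flat_bound 0 (k * (t - a)); have := flat_bound 0 (k * (b - t)).
have := flat_ge0 0 (k * (t - a)); have := flat_ge0 0 (k * (b - t)).
move: (flat 0 _) (flat 0 _) (flat 2 _) (flat 2 _) => x y z w.
rewrite fact0 (_ : 2`! = 2)%N// => y0 x0 y1 x1 w0 z0 w2 z2.
have -> : x * (w * - k) + y * (z * k) = k * (y * z - x * w) by ring.
rewrite normrM ger0_norm// mulrC ler_wpM2r//.
have xw : 0 <= x * w <= 2 by rewrite mulr_ge0//= -[leRHS]mul1r ler_pM.
have yz : 0 <= y * z <= 2 by rewrite mulr_ge0//= -[leRHS]mul1r ler_pM.
by rewrite ler_norml; apply/andP; split; lra.
Qed.

End FlatBounds.

Section Spike.
Context {R : realType} {n : nat}.
Local Notation V := 'rV[R]_n.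
Local Notation mu := (lebesgue_rv R n).
Implicit Types (c : 'I_n -> R) (O : set V).

Lemma smoothZ (k : R) (u : V -> R) : smooth u -> smooth (fun x => k * u x).
Proof.
move=> su s.
have dZ i t x : is_derive x (delta_mx ord0 i) (fun x => k * foldr (@partial R n) u t x)
    (k * partial i (foldr (@partial R n) u t) x).
  have d := derivableP ((su t).2 i x).
  exact: (is_deriveZ k d).
have -> : foldr (@partial R n) (fun x => k * u x) s =
    (fun x => k * foldr (@partial R n) u s x).
  elim: s => //= i s ->; apply/funext => x.
  by case: (dZ i s x).
split; last by move=> i x; case: (dZ i s x).
by have [cs _] := su s; move=> x; exact: (cvgMl_tmp (cs x)).
Qed.

Lemma partialZ (k : R) (u : V -> R) i x : smooth u ->
  partial i (fun x => k * u x) x = k * partial i u x.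
Proof.
move=> su; have d := derivableP ((su [::]).2 i x).
by case: (is_deriveZ k d).
Qed.

Definition cube c (e : R) : set V := cbox (fun i => c i - e) (fun i => c i + e).

Lemma measurable_cube c e : measurable (cube c e).
Proof. exact: measurable_cbox. Qed.

Lemma cube_volume c e : 0 <= e -> mu (cube c e) = ((2 * e) ^+ n)%:E.
Proof.
move=> e0; rewrite /cube /cbox lebesgue_rv_box; last by move=> i; lra.
congr EFin; rewrite (eq_bigr (fun=> 2 * e)) => [|i _]; last by ring.
by rewrite prodr_const card_ord.
Qed.

(** The function A phi((x - c) / e), where phi is the product of the bumps
    [bump_itv 1 (- 1) 1] in each coordinate. *)
Definition spike c (A e : R) : V -> R :=
  fun x => A * bump_box e^-1 (fun i => c i - e) (fun i => c i + e) x.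

Lemma test_function_spike c A e O : 0 < e -> cube c e `<=` O ->
  test_function O (spike c A e).
Proof.
move=> e0; have eV : 0 < e^-1 by rewrite invr_gt0.
apply: test_function_supp; first by apply: smoothZ; exact: smooth_bump_box.
apply: subset_trans (supp_bump_box _ _ _ eV); apply: closure_subset => x /=.
by apply: contraNN => /eqP h; rewrite /spike h mulr0.
Qed.

Lemma spike_ge0 c A e x : 0 <= A -> 0 <= spike c A e x.
Proof. by move=> A0; rewrite mulr_ge0// bump_box_ge0. Qed.

Lemma spike_le c A e x : 0 <= A -> spike c A e x <= A.
Proof. by move=> A0; rewrite -[leRHS]mulr1 ler_wpM2l// bump_box_le1. Qed.

Lemma spike_out c A e x : 0 < e -> ~ cube c e x -> spike c A e x = 0.
Proof.
move=> e0 nx; rewrite /spike bump_box_out ?invr_gt0 ?mulr0// => /obox_cbox.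
exact: nx.
Qed.

(** On the cube of half the size both arguments of [flat 0] are at least 1/2 in
    each coordinate, where [flat 0] is at least exp(-2). *)
Lemma spike_ge c A e x : 0 <= A -> 0 < e -> cube c (e / 2) x ->
  A * expR (- 4) ^+ n <= spike c A e x.
Proof.
move=> A0 e0 cx; rewrite ler_wpM2l// /bump_box /tensor -[X in _ ^+ X]card_ord -prodr_const.
apply: ler_prod => i _; rewrite expR_ge0/=.
have := cx i; rewrite in_itv/= => /andP[h1 h2].
rewrite (_ : - 4 = - 2 + - 2 :> R); last by ring.
rewrite expRD /bump_itv; apply: ler_pM; rewrite ?expR_ge0//; apply: flat0_ge;
  rewrite mulrC ler_pdivlMr//; lra.
Qed.

Lemma spike_partial_le c A e i x : 0 <= A -> 0 < e ->
  `|partial i (spike c A e) x| <= A * (4 * e^-1) * \1_(cube c e) x.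
Proof.
move=> A0 e0; have eV : 0 < e^-1 by rewrite invr_gt0.
rewrite partialZ; last exact: smooth_bump_box.
rewrite normrM ger0_norm// -mulrA ler_wpM2l//.
rewrite indicE; case: (boolP (x \in cube c e)); last first.
  rewrite notin_setE => nx; rewrite partial_out_supp ?normr0 ?mulr0//.
  by move=> /supp_bump_box -/(_ eV).
move=> _; rewrite mulr1 partial_tensor; last by move=> j; exact: smooth1_bump_itv.
rewrite /tensor (bigD1 i)//= normrM -[leRHS]mulr1 ler_pM//.
  by rewrite /tensor_deriv eqxx bump_itv_deriv_le// ltW.
rewrite normr_prod; apply: prodr_ile1 => j ji.
by rewrite normr_ge0 /tensor_deriv (negbTE ji) ger0_norm ?bump_itv_ge0 ?bump_itv_le1.
Qed.

Lemma spike_W_norm_le c A e O p : open O -> bounded_set O -> 1 <= p ->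
  0 <= A -> 0 < e ->
  (W_norm O p%:E (spike c A e) <=
   ((n%:R * (A * (4 * e^-1))) `^ p * (2 * e) ^+ n)%:E `^ p^-1)%E.
Proof.
move=> oO bO p1 A0 e0; have p0 : 0 < p by exact: lt_le_trans p1.
have ss : smooth (spike c A e) by apply: smoothZ; exact: smooth_bump_box.
rewrite W_norm_gradient//; last 2 first.
- exact: smooth_C1_on.
- exact: Lp_partial_smooth.
rewrite EFinM -(cube_volume c e (ltW e0)); apply: Lp_norm_le => //.
  exact: measurable_cube.
apply: aeW => x _; rewrite ger0_norm ?sqrtr_ge0// -mulrA.
by apply: euclid_norm_le => i; rewrite mxE; exact: spike_partial_le.
Qed.

End Spike.

(** * Small functions of negative energy *)
Section NegativeEnergy.
Context {R : realType}.

Lemma powR_lt_small (alpha C delta : R) : 0 < alpha -> 0 <= C -> 0 < delta ->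
  exists2 e1, 0 < e1 & forall e, 0 < e <= e1 -> C * e `^ alpha < delta.
Proof.
move=> a0 C0 d0; have C1 : 0 < C + 1 by rewrite ltr_wpDl.
exists ((delta / (C + 1)) `^ alpha^-1); first by rewrite powR_gt0// divr_gt0.
move=> e /andP[e0 ee1].
have : e `^ alpha <= delta / (C + 1).
  have -> : delta / (C + 1) = ((delta / (C + 1)) `^ alpha^-1) `^ alpha.
    by rewrite -powRrM mulVf ?gt_eqF// powRr1// ltW// divr_gt0.
  by apply: ge0_ler_powR; rewrite ?nnegrE ?powR_ge0 ?(ltW a0) ?(ltW e0).
move=> h; apply: (@le_lt_trans _ _ (C * (delta / (C + 1)))); first exact: ler_wpM2l.
by rewrite mulrA ltr_pdivrMr// mulrC ltr_pM2l// ltrDl.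
Qed.

Lemma integral_scale_indic {d : measure_display} {T : measurableType d}
  (mu : {measure set T -> \bar R}) (D B : set T) (k : R) :
  measurable D -> measurable B -> B `<=` D -> (mu D < +oo)%E ->
  mu.-integrable D (EFin \o (fun x => k * \1_B x)) /\
  (\int[mu]_(x in D) (k * \1_B x)%:E = k%:E * mu B)%E.
Proof.
move=> mD mB BD Dy.
have i1 : mu.-integrable D (EFin \o \1_B).
  apply/integrableP; split; first by apply/measurable_EFinP; exact: measurable_indic.
  under eq_integral do rewrite /= ger0_norm//.
  rewrite integral_indic//; apply: le_lt_trans Dy; apply: le_measure; rewrite ?inE//.
  exact: measurableI.
split; first exact: (integrableZl mD k i1).
under eq_integral do rewrite EFinM.
by rewrite integralZl// integral_indic// (setIidl BD).
Qed.

Variables (n : nat) (p : R) (O : set 'rV[R]_n) (M : R -> R) (f : 'rV[R]_n -> R -> R).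
Variables (r varpi q C1 C2 C3 : R).
Local Notation V := 'rV[R]_n.
Local Notation mu := (lebesgue_rv R n).
Hypotheses (p1 : 1 < p) (pn : p < n%:R) (oO : open O) (bO : bounded_set O).
Hypotheses (pr : p * n%:R / (n%:R - p) < r) (qv : q < varpi) (q1 : 1 <= q).
Hypotheses (C10 : 0 < C1) (C20 : 0 < C2) (C30 : 0 < C3).
Hypothesis M_le : exists2 d : R, 0 < d &
  forall s : R, 0 <= s < d -> p^-1 * Mhat M (s `^ p) <= C1 * s `^ r.
Hypothesis F_ge : forall (x : V) (v : R), O x -> 0 <= v ->
  C2 * v `^ varpi - C3 * v `^ q <= primitive f x v.

Let p0 : 0 < p. Proof. exact: lt_trans p1. Qed.
Let p_ge1 : 1 <= p. Proof. exact: ltW. Qed.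
Let n0 : 0 < n%:R :> R. Proof. exact: lt_trans pn. Qed.
Let np : 0 < n%:R - p. Proof. by rewrite subr_gt0. Qed.
Let r0 : 0 < r. Proof. by apply: lt_trans pr; rewrite divr_gt0// mulr_gt0. Qed.
Let q0 : 0 < q. Proof. exact: lt_le_trans q1. Qed.
Let v0 : 0 < varpi. Proof. exact: lt_trans qv. Qed.

Let K : R := 4 * n%:R * 2 `^ (n%:R / p).
Let eta : R := expR (- 4) ^+ n.

(** The bound of [spike_W_norm_le] for the height A = e^(-a), as a power of e. *)
Lemma spike_W_norm_eq (a e : R) : 0 < e ->
  ((n%:R * (e `^ (- a) * (4 * e^-1))) `^ p * (2 * e) ^+ n) `^ p^-1 =
  K * e `^ (n%:R / p - 1 - a).
Proof.
move=> e0; have e00 := ltW e0.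
rewrite powRM ?powR_ge0 ?exprn_ge0 ?mulr_ge0//.
rewrite -powRrM mulfV ?gt_eqF// powRr1; last first.
  by rewrite !mulr_ge0 ?powR_ge0 ?invr_ge0.
rewrite -powR_mulrn ?mulr_ge0// -powRrM powRM// /K.
rewrite (_ : n%:R / p - 1 - a = n%:R / p + ((-1) + (- a))); last by ring.
have En : e != 0 by rewrite gt_eqF.
by rewrite !(@powRD _ e) ?En ?implybT// powR_inv1//; ring.
Qed.

(** The spike is at least [eta] times its height on the cube of half size, which
    bounds the gain from v^varpi from below; it is at most its height on its
    support, which bounds the loss from v^q. Both bounds are constant on a cube,
    so only the two volumes enter. *)
Lemma spike_energy_lt (c : 'I_n -> R) (a e : R) : 0 < e -> cube c e `<=` O ->
  (forall s : R, 0 <= s <= K * e `^ (n%:R / p - 1 - a) ->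
     p^-1 * Mhat M (s `^ p) <= C1 * s `^ r) ->
  C1 * (K * e `^ (n%:R / p - 1 - a)) `^ r + C3 * ((e `^ (- a)) `^ q * (2 * e) ^+ n)
    < C2 * ((e `^ (- a) * eta) `^ varpi * e ^+ n) ->
  (J O p M f (spike c (e `^ (- a)) e) < 0)%E.
Proof.
move=> e0 eO hM hlt; set A := e `^ (- a); set U := spike c A e.
have A0 : 0 <= A by exact: powR_ge0.
have mO := measurable_open _ oO; have Oy := bounded_lty _ mO bO.
have hW := spike_W_norm_le c A e O p oO bO p_ge1 A0 e0.
rewrite poweR_EFin spike_W_norm_eq// -/U in hW.
have W0 : (0 <= W_norm O p%:E U)%E by exact: Lp_norm_ge0.
have Wfin : W_norm O p%:E U \is a fin_num.
  by rewrite ge0_fin_numE// (le_lt_trans hW)// ltry.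
set w := fine (W_norm O p%:E U).
have w0 : 0 <= w by exact: fine_ge0.
have wK : w <= K * e `^ (n%:R / p - 1 - a) by rewrite -lee_fin fineK.
have kin : p^-1 * Mhat M (w `^ p) <= C1 * (K * e `^ (n%:R / p - 1 - a)) `^ r.
  apply: (le_trans (hM w _)); first by rewrite w0.
  rewrite ler_pM2l//; apply: ge0_ler_powR; rewrite ?nnegrE ?(ltW r0)//.
  exact: le_trans wK.
have small_sub : cube c (e / 2) `<=` O.
  apply: subset_trans eO => x h i; have := h i; rewrite !in_itv/= => /andP[h1 h2].
  by apply/andP; split; lra.
(* The constants on the two cubes of the step function that bounds F(x, U x)
   from below. *)
pose k1 := C2 * (A * eta) `^ varpi; pose k2 := C3 * A `^ q.
have [i1 E1] := integral_scale_indic mu _ _ k1 mO (measurable_cube c (e / 2)) small_sub Oy.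
have [i2 E2] := integral_scale_indic mu _ _ k2 mO (measurable_cube c e) eO Oy.
have FE : (((k1 * e ^+ n) - k2 * (2 * e) ^+ n)%:E <=
    \int[mu]_(x in O) (primitive f x (U x))%:E)%E.
  have <- : (\int[mu]_(x in O) (k1 * \1_(cube c (e / 2)) x - k2 * \1_(cube c e) x)%:E =
      ((k1 * e ^+ n) - k2 * (2 * e) ^+ n)%:E)%E.
    under eq_integral do rewrite EFinB.
    rewrite (integralB mO i1 i2) EFinB; congr (_ - _)%E.
      transitivity (k1%:E * mu (cube c (e / 2)))%E; first exact: E1.
      by rewrite cube_volume ?divr_ge0 ?(ltW e0)// (_ : 2 * (e / 2) = e)//; field.
    transitivity (k2%:E * mu (cube c e))%E; first exact: E2.
    by rewrite cube_volume ?(ltW e0).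
  apply: le_integral_nonmeas => x Ox; rewrite lee_fin.
  apply: le_trans (F_ge x _ Ox (spike_ge0 c A e x A0)).
  apply: lerB; rewrite -mulrA ler_pM2l//.
    rewrite indicE; case: (boolP (x \in _)) => [|_]; last by rewrite mulr0 powR_ge0.
    rewrite inE => xs; rewrite mulr1; apply: ge0_ler_powR; rewrite ?nnegrE ?(ltW v0)//.
    - by rewrite mulr_ge0// exprn_ge0// expR_ge0.
    - exact: spike_ge0.
    - exact: spike_ge.
  rewrite indicE; case: (boolP (x \in _)) => [_|].
    rewrite mulr1; apply: ge0_ler_powR; rewrite ?nnegrE ?(ltW q0)//.
    - exact: spike_ge0.
    - exact: spike_le.
  by rewrite notin_setE => nx; rewrite spike_out// powR0 ?gt_eqF// mulr0.
rewrite /J; apply: (@le_lt_trans _ _ ((C1 * (K * e `^ (n%:R / p - 1 - a)) `^ r)%:E -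
  ((k1 * e ^+ n) - k2 * (2 * e) ^+ n)%:E)%E).
  by apply: leeB FE; rewrite lee_fin.
by rewrite -EFinB lte_fin; move: hlt; rewrite /k1 /k2 /A; lra.
Qed.

(** The exponent a is half of (n/p - 1) - n/r, which is positive since r > p^*.
    Divided by e^(n - a varpi), the inequality of [spike_energy_lt] says that two
    positive powers of e, of exponents b1 and b2, stay below a constant. *)
Lemma exists_small_negative_energy (delta : R) : O !=set0 -> 0 < delta ->
  exists u, [/\ W01p O p%:E u, (W_norm O p%:E u < delta%:E)%E & (J O p M f u < 0)%E].
Proof.
move=> [x0 Ox0] delta0.
have [d d0 hd] := M_le.
have Nr : n%:R / r < n%:R / p - 1.
  rewrite ltr_pdivrMr// (_ : n%:R / p - 1 = (n%:R - p) / p); last first.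
    by rewrite mulrBl divff ?gt_eqF.
  move: pr; rewrite ltr_pdivrMr// => h.
  by rewrite mulrAC ltr_pdivlMr//; lra.
pose a := (n%:R / p - 1 - n%:R / r) / 2.
have a0 : 0 < a by rewrite divr_gt0// subr_gt0.
pose sg := n%:R / p - 1 - a.
have sgr : n%:R < sg * r.
  by rewrite -ltr_pdivrMr// /sg /a; lra.
have nr0 : 0 < n%:R / r by rewrite divr_gt0.
have sg0 : 0 < sg by rewrite -(pmulr_lgt0 _ r0); exact: lt_trans sgr.
have K0 : 0 < K by rewrite /K !mulr_gt0// powR_gt0.
have eta0 : 0 < eta by rewrite exprn_gt0// expR_gt0.
pose b1 := sg * r - n%:R + a * varpi; pose b2 := a * (varpi - q).
have b10 : 0 < b1 by rewrite addr_gt0 ?subr_gt0// mulr_gt0.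
have b20 : 0 < b2 by rewrite mulr_gt0// subr_gt0.
(* Half of the constant for each of the two powers. *)
pose T := C2 * eta `^ varpi / 2.
have T0 : 0 < T by rewrite divr_gt0// mulr_gt0// powR_gt0.
have c1 : 0 <= C1 * K `^ r by rewrite mulr_ge0 ?(ltW C10)// powR_ge0.
have [e1 e10 he1] := powR_lt_small b1 (C1 * K `^ r) T b10 c1 T0.
have c2 : 0 <= C3 * 2 ^+ n by rewrite mulr_ge0 ?(ltW C30)// exprn_ge0.
have [e2 e20 he2] := powR_lt_small b2 (C3 * 2 ^+ n) T b20 c2 T0.
have md0 : 0 < Num.min d delta by rewrite lt_min d0.
have [e3 e30 he3] := powR_lt_small sg K _ sg0 (ltW K0) md0.
have /nbhs_ballP[e4 /= e40 he4] : nbhs x0 O by exact: open_nbhs_nbhs.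
(* [e1] and [e2] give the energy inequality, [e3] keeps the W-norm below [delta]
   and within the range of (i), and [e4 / 2] keeps the cube inside [O]. *)
pose e := Num.min (Num.min e1 e2) (Num.min e3 (e4 / 2)).
have e0 : 0 < e by rewrite !lt_min e10 e20 e30 divr_gt0.
have ee1 : 0 < e <= e1 by rewrite e0 /e !ge_min lexx.
have ee2 : 0 < e <= e2 by rewrite e0 /e !ge_min lexx !orbT.
have ee3 : 0 < e <= e3 by rewrite e0 /e !ge_min lexx !orbT.
have ee4 : e <= e4 / 2 by rewrite /e !ge_min lexx !orbT.
pose c i := x0 ord0 i.
have eO : cube c e `<=` O.
  move=> x hx; apply: he4; apply/ball_coord => // i; have := hx i.
  by rewrite in_itv/= /c => /andP[h1 h2]; rewrite ltr_norml; apply/andP; split; lra.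
have := he3 e ee3; rewrite lt_min => /andP[Kd Kdelta].
exists (spike c (e `^ (- a)) e); split.
- by apply: test_function_W01p => //; exact: test_function_spike.
- apply: le_lt_trans (spike_W_norm_le _ _ _ _ _ oO bO p_ge1 (powR_ge0 _ _) e0) _.
  by rewrite poweR_EFin spike_W_norm_eq// lte_fin.
- apply: spike_energy_lt => //.
    by move=> s /andP[s0 sK]; apply: hd; rewrite s0 (le_lt_trans sK).
  have En : e != 0 by rewrite gt_eqF.
  have e00 := ltW e0.
  pose P := e `^ (n%:R - a * varpi).
  have P0 : 0 < P by exact: powR_gt0.
  have -> : (K * e `^ (n%:R / p - 1 - a)) `^ r = K `^ r * e `^ b1 * P.
    rewrite powRM ?powR_ge0 ?(ltW K0)// -powRrM -/sg -mulrA -powRD ?En ?implybT//.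
    by congr (_ * _ `^ _); rewrite /b1; ring.
  have -> : (e `^ (- a)) `^ q * (2 * e) ^+ n = 2 ^+ n * e `^ b2 * P.
    rewrite exprMn mulrCA -powRrM -(powR_mulrn n e00) -!mulrA -!powRD ?En ?implybT//.
    by congr (_ * _ `^ _); rewrite /b2; ring.
  have -> : (e `^ (- a) * eta) `^ varpi * e ^+ n = eta `^ varpi * P.
    rewrite powRM ?powR_ge0 ?(ltW eta0)// -powRrM mulrC mulrA.
    rewrite -(powR_mulrn n e00) -powRD ?En ?implybT// mulrC.
    by congr (_ * _ `^ _); ring.
  have h1 := he1 _ ee1; have h2 := he2 _ ee2.
  have -> : C1 * (K `^ r * e `^ b1 * P) + C3 * (2 ^+ n * e `^ b2 * P) =
    (C1 * K `^ r * e `^ b1 + C3 * 2 ^+ n * e `^ b2) * P by ring.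
  rewrite mulrA ltr_pM2r//; rewrite /T in h1 h2; lra.
Qed.

End NegativeEnergy.

(** * Local minimality of the origin *)
Section LocalMinima.
Context {R : realType} {n : nat}.
Local Notation V := 'rV[R]_n.
Local Notation mu := (lebesgue_rv R n).
Variables (p : R) (O : set V) (M : R -> R) (f : V -> R -> R).
Hypotheses (p_ge1 : 1 <= p) (oO : open O) (bO : bounded_set O).

Let p0 : 0 < p. Proof. exact: lt_le_trans p_ge1. Qed.

Lemma Rintegral_point (h : R -> R) (a : R) :
  \int[@lebesgue_measure R]_(s in `[a, a]) h s = 0.
Proof. by rewrite set_itv1 /Rintegral integral_set1. Qed.

Lemma primitive0 (x : V) : primitive f x 0 = 0.
Proof. by rewrite /primitive /oriented_integral lexx Rintegral_point. Qed.

Lemma Mhat0 : Mhat M 0 = 0.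
Proof. exact: Rintegral_point. Qed.

Lemma J_origin : J O p M f (fun=> 0) = 0%E.
Proof.
rewrite /J W_norm0//= powR0 ?gt_eqF// Mhat0 mulr0 sub0e.
by rewrite integral0_eq ?oppe0// => x _; rewrite primitive0.
Qed.

Lemma J_ge0 u : 0 <= Mhat M (fine (W_norm O p%:E u) `^ p) ->
  {ae mu, forall x, O x -> primitive f x (u x) <= 0} -> (0 <= J O p M f u)%E.
Proof.
move=> M0 F0; rewrite /J -[leLHS](sube0 0%E); apply: leeB.
  by rewrite lee_fin mulr_ge0// invr_ge0 ltW.
rewrite -[leRHS](integral0 mu O); apply: ae_le_integral_nonmeas.
by apply: filterS F0 => x h Ox; rewrite lee_fin h.
Qed.

Lemma not_local_min_of_sequence (u : nat -> V -> R) :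
  (forall k, W01p O p%:E (u k)) -> W_norm O p%:E (u k) @[k --> \oo] --> 0%E ->
  (forall k, (J O p M f (u k) < 0)%E) -> ~ local_min_W O p (J O p M f).
Proof.
move=> Wu u0 Ju [rho rho0 h].
have [k hk] : exists k, (W_norm O p%:E (u k) < rho%:E)%E.
  have : nbhs (0 : \bar R) [set y | (y < rho%:E)%E].
    by apply: open_nbhs_nbhs; split => //; exact: open_ereal_lt_ereal.
  by move=> /u0[k _ /(_ k (leqnn k))]; exists k.
by have := h _ (Wu k) (Wu k) hk; rewrite J_origin leNgt Ju.
Qed.

Lemma C1_closure_C1_on u : C1_closure O u -> C1_on O u.
Proof.
have cont w : (exists2 v : V -> R, {within closure O, continuous v} & {in O, w =1 v}) ->
    forall x, O x -> {for x, continuous w}.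
  move=> [v cv wv] x Ox.
  have {}cv : {within O, continuous v}.
    exact: continuous_subspaceW (@subset_closure _ O) cv.
  rewrite continuous_open_subspace// in cv.
  have vx : {for x, continuous v} by apply: cv; rewrite inE.
  rewrite /prop_for /continuous_at wv ?inE//.
  apply: cvg_trans vx; apply: (@near_eq_cvg _ _ (nbhs x)).
  have : nbhs x O by exact: open_nbhs_nbhs.
  by apply: filterS => y Oy; rewrite wv ?inE.
move=> [du cu cdu] x Ox; split; first exact: cont cu x Ox.
by move=> i; split; [exact: du|exact: cont (cdu i) x Ox].
Qed.

Lemma C1_norm_lt (u : V -> R) rho : O !=set0 -> (C1_norm O u < rho%:E)%E ->
  forall x, O x -> `|u x| < rho /\ euclid_norm (gradient u x) < rho.
Proof.
move=> [x0 Ox0]; rewrite /C1_norm; set s1 := ereal_sup _; set s2 := ereal_sup _ => h.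
have ub1 x : O x -> (`|u x|%:E <= s1)%E by move=> Ox; apply: ereal_sup_ubound; exists x.
have ub2 x : O x -> ((euclid_norm (gradient u x))%:E <= s2)%E.
  by move=> Ox; apply: ereal_sup_ubound; exists x.
have s10 : (0 <= s1)%E by apply: le_trans (ub1 _ Ox0); rewrite lee_fin.
have s20 : (0 <= s2)%E by apply: le_trans (ub2 _ Ox0); rewrite lee_fin sqrtr_ge0.
move=> x Ox; split; rewrite -lte_fin; apply: le_lt_trans h.
- by apply: le_trans (ub1 _ Ox) _; rewrite leeDl.
- by apply: le_trans (ub2 _ Ox) _; rewrite leeDr.
Qed.

(** A function of C^1 norm below rho has |u|_W^p <= rho^p |Omega|, so that a small
    rho keeps |u|_W^p in the range where Mhat is nonnegative. *)
Lemma local_min_C1_of_sign : O !=set0 ->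
  (exists2 d : R, 0 < d & forall t : R, 0 <= t < d -> 0 <= Mhat M t) ->
  (exists2 d : R, 0 < d & forall x v, O x -> `|v| < d -> primitive f x v <= 0) ->
  local_min_C1 O p (J O p M f).
Proof.
move=> nO [d1 d10 Mge0] [d2 d20 Fle0].
have mO := measurable_open _ oO; have Oy := bounded_lty _ mO bO.
pose m := fine (mu O).
have m0 : 0 <= m by exact: fine_ge0.
have mE : mu O = m%:E by rewrite fineK// ge0_fin_numE.
have [e1 e10 he1] := powR_lt_small p m d1 p0 m0 d10.
exists (Num.min e1 d2) => [|u _ Cu Nu]; first by rewrite lt_min e10.
have small := C1_norm_lt _ _ nO Nu.
have rho0 : 0 < Num.min e1 d2 by rewrite lt_min e10.
set rho := Num.min e1 d2 in Nu small rho0.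
have C1u := C1_closure_C1_on _ Cu.
have Lu i : Lp O p%:E (partial i u).
  apply: (Lp_bounded _ _ _ rho) => //.
    by apply: measurable_continuous => // x /C1u[_ /(_ i)[]].
  move=> x Ox; have [_ /ltW] := small x Ox; apply: le_trans.
  by have := euclid_norm_ge_coord (gradient u x) i; rewrite mxE.
rewrite J_origin; apply: J_ge0; last first.
  apply: aeW => x Ox; apply: Fle0 => //.
  by have [] := small x Ox; rewrite lt_min => /andP[].
apply: Mge0; rewrite powR_ge0/=.
have hW : (W_norm O p%:E u <= ((rho `^ p * m) `^ p^-1)%:E)%E.
  rewrite W_norm_gradient// -poweR_EFin EFinM -mE; apply: Lp_norm_le => //.
  apply: aeW => x Ox; rewrite indicE mem_set// mulr1 ger0_norm ?sqrtr_ge0//.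
  by have [_ /ltW] := small x Ox.
have Wfin : W_norm O p%:E u \is a fin_num.
  by rewrite ge0_fin_numE ?Lp_norm_ge0// (le_lt_trans hW)// ltry.
apply: (@le_lt_trans _ _ (m * rho `^ p)); last first.
  by apply: he1; rewrite rho0 /rho ge_min lexx.
rewrite mulrC -[leRHS]powRr1 ?mulr_ge0 ?powR_ge0//.
rewrite -[X in _ <= _ `^ X](@mulVf _ p) ?gt_eqF// powRrM.
apply: ge0_ler_powR; rewrite ?nnegrE ?powR_ge0 ?(ltW p0)//.
  by rewrite fine_ge0 ?Lp_norm_ge0.
by rewrite -lee_fin fineK.
Qed.

Lemma ae_lt_Lp_norm_infty (u : V -> R) (d : R) : (Lp_norm O +oo u < d%:E)%E ->
  {ae mu, forall x, O x -> `|u x| < d}.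
Proof.
rewrite /Lp_norm unlock; case: ifPn => [_ h|].
  have := ess_sup_ge mu (abse \o ((EFin \o u) \_ O)).
  apply: filterS => x hx Ox; rewrite -lte_fin; apply: le_lt_trans h.
  by move: hx; rewrite /= patchE mem_set.
(* The L^oo norm is the essential supremum only when the whole space has
   positive measure; otherwise every property holds almost everywhere. *)
rewrite lt0e measure_ge0 andbT negbK => /eqP m0 _.
by exists setT; split => //; exact: measurableT.
Qed.

Lemma local_min_Loo_of_sign : (forall t : R, 0 <= t -> 0 <= Mhat M t) ->
  (exists2 d : R, 0 < d & forall x v, O x -> `|v| < d -> primitive f x v <= 0) ->
  local_min_Loo O p (J O p M f).
Proof.
move=> Mge0 [d d0 Fle0]; exists d; first exact: d0.
move=> u _ _ nu; have ud := ae_lt_Lp_norm_infty u d nu.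
rewrite J_origin; apply: J_ge0; first by apply: Mge0; exact: powR_ge0.
by apply: filterS ud => x h Ox; apply: Fle0 => //; exact: h.
Qed.

End LocalMinima.

Theorem theorem2p1 (R : realType) (N : nat) (p : R) (O : set 'rV[R]_N)
    (M : R -> R) (f : 'rV[R]_N -> R -> R)
    (r varpi q C0 C1 C2 C3 : R) :
  let pstar := p * N%:R / (N%:R - p) in
  let F := primitive f in
  let JJ := J O p M f in
  1 < p -> p < N%:R -> bounded_domain O ->
  (@lebesgue_measure R).-integrable `]0, 1] (EFin \o M) ->
  (forall t : R, 0 < t -> {for t, continuous M}) ->
  (forall x, O x -> locally_integrable_R (f x)) ->
  caratheodory O F ->
  0 < C0 -> (forall x v, O x -> F x v <= C0 * (1 + `|v| `^ pstar)) ->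
  pstar < r -> varpi <= pstar -> q < varpi -> 1 <= q ->
  0 < C1 -> 0 < C2 -> 0 < C3 ->
  (exists2 d : R, 0 < d &
     forall s : R, 0 <= s < d -> p^-1 * Mhat M (s `^ p) <= C1 * s `^ r) ->
  (forall (x : 'rV[R]_N) (v : R), O x -> 0 <= v -> C2 * v `^ varpi - C3 * v `^ q <= F x v) ->
  [/\ exists u : nat -> 'rV[R]_N -> R,
        [/\ forall k, W01p O p%:E (u k),
            W_norm O p%:E (u k) @[k --> \oo] --> 0%E &
            forall k, (JJ (u k) < 0)%E],
      (exists2 d : R, 0 < d & forall t : R, 0 <= t < d -> 0 <= Mhat M t) ->
      (exists2 d : R, 0 < d & forall x v, O x -> `|v| < d -> F x v <= 0) ->
      local_min_C1 O p JJ /\ ~ local_min_W O p JJ &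
      (forall t : R, 0 <= t -> 0 <= Mhat M t) ->
      (exists2 d : R, 0 < d & forall x v, O x -> `|v| < d -> F x v <= 0) ->
      [/\ local_min_C1 O p JJ, local_min_Loo O p JJ & ~ local_min_W O p JJ]].
Proof.
move=> pstar F JJ p1 pN [oO _ nO bO] _ _ _ _ _ _ pr _ qv q1 C10 C20 C30 M_le F_ge.
have p_ge1 := ltW p1.
have neg (k : nat) := exists_small_negative_energy N p O M f r varpi q C1 C2 C3 p1 pN oO bO pr
  qv q1 C10 C20 C30 M_le F_ge k.+1%:R^-1 nO.
have k0 (k : nat) : 0 < k.+1%:R^-1 :> R by rewrite invr_gt0.
have {neg k0} [u hu] := choice (fun k => neg k (k0 k)).
have Wu k : W01p O p%:E (u k) by have [] := hu k.
have Ju k : (JJ (u k) < 0)%E by have [] := hu k.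
have u0 : W_norm O p%:E (u k) @[k --> \oo] --> 0%E.
  apply: (@squeeze_cvge _ _ _ _ (fun=> 0%E) _ (fun k => (k.+1%:R^-1)%:E)).
  - by apply: nearW => k; rewrite Lp_norm_ge0/=; have [_ /ltW] := hu k.
  - exact: cvg_cst.
  - by apply: cvg_EFin; [exact: nearW|exact: cvg_harmonic].
have notW := not_local_min_of_sequence _ _ _ _ p_ge1 oO bO _ Wu u0 Ju.
split; first by exists u.
- by move=> Mge0 Fle0; split => //; exact: local_min_C1_of_sign.
- move=> Mge0 Fle0; split => //; last exact: local_min_Loo_of_sign.
  by apply: local_min_C1_of_sign => //; exists 1 => // t /andP[t0 _]; exact: Mge0.
Qed.
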